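(* There exists an absolute constant $c>0$ such that for any $\epsilon>0$, $0<\delta<0.1$, positive integers $m<n/2$, any $\sigma_1^2,\dots,\sigma_n^2>0$, and any algorithm that solves the $(\epsilon,\delta)$ top-$m$ arm identification problem, there exists an instance with the given variance proxies on which the expected number of samples of the algorithm is at least \[ c\left(\sum_{i\in[n]}\frac{\sigma_i^2}{\epsilon^2}\ln\frac1\delta+\sum_{i\in G^{m}}\frac{\sigma_i^2}{\epsilon^2}\ln(m)+\sum_{j\in G^{l}}\frac{\sigma_j^2}{\epsilon^2}\mathrm{Ent}(\sigma^2_{G^{r}})\right). \]
   Context: Bandit setting: $n$ arms; pulling arm $i$ returns an independent sample from a distribution $\nu_i$ with unknown mean $\mu_i$ that is $\sigma_i^2$-sub-Gaussian ($\ln\mathbb E[e^{\lambda(X-\mu_i)}]\le\sigma_i^2\lambda^2/2$ for all real $\lambda$), $\sigma_i^2$ known; an instance with the given variance proxies is any such tuple $(\nu_1,\dots,\nu_n)$. An algorithm adaptively pulls arms, stops, and returns $m$ arms; $\max^m_{i\in S}\mu_i$ is the $m$-th largest mean in $S$; an arm is $\epsilon$-approximate top-$m$ if its mean is $\ge\max^m_{i\in[n]}\mu_i-\epsilon$; the algorithm solves the $(\epsilon,\delta)$ top-$m$ arm identification problem if on every instance, with probability $\ge1-\delta$, all returned arms are $\epsilon$-approximate top-$m$. Entropy: $\mathrm{Ent}(a)=-\sum_i\hat a_i\ln\hat a_i$, $\hat a_i=a_i/\sum_ja_j$; $\sigma^2_S=(\sigma_i^2)_{i\in S}$. Grouping: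 $\underline\sigma^2=\min_i\sigma_i^2$, $G_j=\{i:2^{j-1}\le\sigma_i^2/\underline\sigma^2<2^j\}$, $j=1,\dots,k$ covering $[n]$. $G^{m}=\bigcup_{j:|G_j|>2m}G_j$, $G^{l}=\bigcup_{j:|G_j|\le2m}G_j$. $G'_j=G_j$ if $|G_j|\le2m$, otherwise $G'_j\subset G_j$ with $|G'_j|=2m$; $G^{r}=\bigcup_jG'_j$ with the choices made to maximize $\mathrm{Ent}(\sigma^2_{G^{r}})$. *)

(* Defs.v *)
From HB Require Import structures.
From mathcomp Require Import all_boot all_order all_algebra.
From mathcomp Require Import all_classical all_reals all_analysis.
Set Implicit Arguments. Unset Strict Implicit. Unset Printing Implicit Defensive.
Import Order.TTheory GRing.Theory Num.Theory.
Local Open Scope ring_scope.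
Local Open Scope classical_set_scope.

Section Bandit.
Variable R : realType.

Definition mean (nu : probability R R) : R := fine (\int[nu]_x (x%:E))%E.

(* sigma2-sub-Gaussian: integrable, and for every real lambda
   ln E[exp(lambda (X - mu))] <= sigma2 lambda^2 / 2, written with exp on both sides *)
Definition subgaussian (nu : probability R R) (sigma2 : R) : Prop :=
  nu.-integrable setT EFin /\
  forall lam : R,
    (\int[nu]_x (expR (lam * (x - mean nu)))%:E <= (expR (sigma2 * lam ^+ 2 / 2))%:E)%E.

(* an action: pull arm i (inl i) or stop and return the set A (inr A) *)
Definition Act (n : nat) : finType := ('I_n + {set 'I_n})%type.

(* history = sequence of (pulled arm, observed reward);
   a (randomized, behavioural) policy gives the probability of each action *)
Definition policy (n : nat) := seq ('I_n * R) -> Act n -> R.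

Definition is_algorithm (n m : nat) (pi : policy n) : Prop :=
  [/\ (forall h a, 0 <= pi h a),
      (forall h, \sum_(a : Act n) pi h a = 1),
      (forall h (A : {set 'I_n}), #|A| != m -> pi h (inr A) = 0) &
      (forall (k : nat) (s : k.-tuple 'I_n) (a : Act n),
          measurable_fun [set: k.-tuple R] (fun x : k.-tuple R => pi (zip s x) a))].

(* run pi nu f T h : expected payoff f(A) of the returned set A, restricted to the
   event that the algorithm stops after at most T further pulls, starting from history h,
   when arm i yields independent samples from nu i *)
Fixpoint run (n : nat) (pi : policy n) (nu : 'I_n -> probability R R)
    (f : {set 'I_n} -> \bar R) (T : nat) (h : seq ('I_n * R)) {struct T} : \bar R :=
  (\sum_(a : Act n)
     (pi h a)%:E *
     match a with
     | inr A => f A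
     | inl i => match T with
                | 0 => 0
                | T'.+1 => \int[nu i]_x run pi nu f T' (rcons h (i, x))
                end
     end)%E.

Definition mth_largest (n : nat) (mu : 'I_n -> R) (m : nat) : R :=
  nth 0 (sort (fun x y : R => y <= x) [seq mu i | i <- enum 'I_n]) m.-1.

Definition good_set (n m : nat) (eps : R) (mu : 'I_n -> R) (A : {set 'I_n}) : bool :=
  [forall i in A, mth_largest mu m - eps <= mu i].

Definition prob_correct (n m : nat) (eps : R) (pi : policy n)
    (nu : 'I_n -> probability R R) : \bar R :=
  ereal_sup (range (fun T => run pi nu
     (fun A => if good_set m eps (fun i => mean (nu i)) A then 1%E else 0%E) T [::])).

(* expected number of samples: E[tau] = sum_{t >= 0} P(tau > t) *)
Definition expected_samples (n : nat) (pi : policy n) (nu : 'I_n -> probability R R)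
  : \bar R :=
  (\sum_(0 <= t <oo) (1 - run pi nu (fun _ => 1) t [::]))%E.

Definition instance_of (n : nat) (sigma2 : 'I_n -> R) (nu : 'I_n -> probability R R)
  : Prop := forall i, subgaussian (nu i) (sigma2 i).

Definition solves (n m : nat) (eps delta : R) (sigma2 : 'I_n -> R) (pi : policy n)
  : Prop :=
  forall nu : 'I_n -> probability R R, instance_of sigma2 nu ->
    ((1 - delta)%:E <= prob_correct m eps pi nu)%E.

Definition Ent (n : nat) (a : 'I_n -> R) (A : {set 'I_n}) : R :=
  - \sum_(i in A) (a i / \sum_(j in A) a j) * ln (a i / \sum_(j in A) a j).

Definition sigma_min (n : nat) (sigma2 : 'I_n -> R) : R :=
  fine (\big[mine/+oo%E]_(i < n) (sigma2 i)%:E).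

Definition group (n : nat) (sigma2 : 'I_n -> R) (j : nat) : {set 'I_n} :=
  [set i | (2 ^+ j.-1 <= sigma2 i / sigma_min sigma2)
           && (sigma2 i / sigma_min sigma2 < 2 ^+ j)].

Definition in_Gm (n m : nat) (sigma2 : 'I_n -> R) (i : 'I_n) : Prop :=
  exists j, (0 < j)%N /\ i \in group sigma2 j /\ (2 * m < #|group sigma2 j|)%N.

Definition in_Gl (n m : nat) (sigma2 : 'I_n -> R) (i : 'I_n) : Prop :=
  exists j, (0 < j)%N /\ i \in group sigma2 j /\ (#|group sigma2 j| <= 2 * m)%N.

(* A = union of the G'_j for an admissible choice of the G'_j *)
Definition admissible_Gr (n m : nat) (sigma2 : 'I_n -> R) (A : {set 'I_n}) : Prop :=
  forall j, (0 < j)%N ->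
    ((#|group sigma2 j| <= 2 * m)%N -> A :&: group sigma2 j = group sigma2 j) /\
    ((2 * m < #|group sigma2 j|)%N -> #|A :&: group sigma2 j| = (2 * m)%N).

Definition Ent_Gr (n m : nat) (sigma2 : 'I_n -> R) : R :=
  \big[Num.max/0]_(A : {set 'I_n} | `[< admissible_Gr m sigma2 A >]) Ent sigma2 A.

Definition lower_bound (n m : nat) (eps delta : R) (sigma2 : 'I_n -> R) : R :=
  \sum_(i < n) sigma2 i / eps ^+ 2 * ln (1 / delta)
  + \sum_(i < n | `[< in_Gm m sigma2 i >]) sigma2 i / eps ^+ 2 * ln m%:R
  + \sum_(j < n | `[< in_Gl m sigma2 j >]) sigma2 j / eps ^+ 2 * Ent_Gr m sigma2.

End Bandit.

(* Main.v *)
(* All arms are Gaussian with means in {2 eps, 0, -2 eps}, and the algorithm is a stopped process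
   unrolled over at most T pulls. A change of the law of one arm i by 2 eps gives, for every event E
   on the returned set and every t >= 0,
     t P(E) <= (e^t - 1) P'(E) + (2 eps^2 / sigma_i^2) E[number of pulls of i].
   Raising or lowering one arm when m - 1 arms are good yields the term with ln (1 / delta).
   For the other two terms, draw a random set S of good arms, including i with probability about
   min(1, m sigma_i^2 / W) / 4 where W = sum_i sigma_i^2, and complete it to m good arms. If one
   raises a further arm i, then S + i has become the random set, and the events "the output misses
   exactly i" are disjoint for i in S + i; averaging over S with e^t = min(m, W / sigma_i^2) bounds
   the number of pulls by a multiple of F = sum_i sigma_i^2 ln min(m, W / sigma_i^2), up to O(W).
   Finally F dominates both remaining terms up to O(W): an arm of a large group has
   m sigma_i^2 <= W, and the arms of G^r with sigma_i^2 < W / m contribute a geometric sum. *)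
Require Import Defs.
From HB Require Import structures.
From mathcomp Require Import all_boot all_order all_algebra.
From mathcomp Require Import all_classical all_reals all_analysis.
From mathcomp Require Import measurable_realfun ring lra zify.
Set Implicit Arguments. Unset Strict Implicit. Unset Printing Implicit Defensive.
Import Order.TTheory GRing.Theory Num.Theory.
Import numFieldNormedType.Exports.
Local Open Scope ring_scope.

(** * Integrability of real functions under a probability measure *)

Section RealIntegrability.
Context d (T : measurableType d) (R : realType) (P : probability T R).
Implicit Types (f g : T -> R) (c : R).

Lemma integrable_realD f g :
    P.-integrable setT (EFin \o f) -> P.-integrable setT (EFin \o g) ->
  P.-integrable setT (EFin \o (fun x => f x + g x)).
Proof. by move=> hf hg; exact: (integrableD measurableT hf hg). Qed.

Lemma integrable_realZ c f :
    P.-integrable setT (EFin \o f) ->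
  P.-integrable setT (EFin \o (fun x => c * f x)).
Proof. by move=> hf; exact: (integrableZl measurableT c hf). Qed.

Lemma integrable_real_cst c : P.-integrable setT (EFin \o (fun=> c)).
Proof. exact/finite_measure_integrable_cst. Qed.

Lemma integrable_bounded f M : measurable_fun setT f ->
  (forall x, `|f x| <= M) -> P.-integrable setT (EFin \o f).
Proof.
move=> mf fM; apply: (le_integrable measurableT _ _ (integrable_real_cst M)).
  exact/measurable_EFinP.
by move=> x _ /=; rewrite lee_fin (le_trans (fM x))// ler_norm.
Qed.

Lemma Rintegral_prob_cst c : \int[P]_x c = c.
Proof. by rewrite Rintegral_cst// [X in fine X]probability_setT mulr1. Qed.

End RealIntegrability.

(** * Gaussian arms: moment generating function, mean, likelihood ratio *)

Section GaussianArm.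
Context {R : realType}.
Local Notation mu := (@lebesgue_measure R).
Implicit Types (m s t x : R).

(* [normal_prob] lives on the Borel space [measurableTypeR R], whose display differs from
   that of the measurable type [R]. *)
Definition borel_id : measurableTypeR R -> R := idfun.

Lemma measurable_borel_id : measurable_fun setT borel_id.
Proof. exact: measurable_id. Qed.

HB.instance Definition _ :=
  @isMeasurableFun.Build _ _ (measurableTypeR R) R borel_id measurable_borel_id.

Definition gauss_arm m s : probability R R :=
  distribution (normal_prob m s) borel_id.

(** The Radon-Nikodym derivative of [normal_prob] agrees almost everywhere with [normal_pdf], since
    both have the same integral over every measurable set. *)
Lemma ge0_integral_gauss_arm m s (g : R -> \bar R) :
    (forall x, 0 <= g x)%E -> measurable_fun setT g ->
  (\int[gauss_arm m s]_x g x = \int[mu]_x (g x * (normal_pdf m s x)%:E))%E.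
Proof.
move=> g0 mg; have dom := normal_prob_dominates m s.
rewrite ge0_integral_pushforward//.
transitivity (\int[normal_prob m s]_x g x)%E => //.
rewrite -(Radon_Nikodym_SigmaFinite.change_of_variables dom)//.
have mRN : measurable_fun setT
    (Radon_Nikodym_SigmaFinite.f (normal_prob m s) mu).
  exact: measurable_int (Radon_Nikodym_SigmaFinite.f_integrable dom).
apply: ae_eq_integral => //.
- exact: emeasurable_funM.
- apply: emeasurable_funM => //.
  by apply/measurable_EFinP; exact: measurable_normal_pdf.
apply: ae_eqe_mul2l; apply: integral_ae_eq => //.
- exact: Radon_Nikodym_SigmaFinite.f_integrable.
- by apply/measurable_EFinP; exact: measurable_normal_pdf.
- by move=> A _ mA; rewrite -Radon_Nikodym_SigmaFinite.f_integral.
Qed.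

Lemma normal_pdf_shift m m' s x : s != 0 ->
  normal_pdf m' s x =
  expR ((m' - m) / s ^+ 2 * (x - (m + m') / 2)) * normal_pdf m s x.
Proof.
move=> s0; rewrite !normal_pdfE// mulrCA; congr *%R.
by rewrite /normal_fun -expRD; congr expR; field.
Qed.

(** Exponential tilting of a Gaussian shifts its mean, so the moment generating function reduces to
    the total mass of a density. *)
Lemma normal_pdf_tilt m s t x : s != 0 ->
  expR (t * (x - m)) * normal_pdf m s x =
  expR (s ^+ 2 * t ^+ 2 / 2) * normal_pdf (m + s ^+ 2 * t) s x.
Proof.
move=> s0; rewrite (normal_pdf_shift m (m + s ^+ 2 * t))// mulrA -expRD.
by congr (expR _ * _); field.
Qed.

Lemma normal_mgf m s t : s != 0 ->
  (\int[gauss_arm m s]_x (expR (t * (x - m)))%:E =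
   (expR (s ^+ 2 * t ^+ 2 / 2))%:E)%E.
Proof.
move=> s0; rewrite ge0_integral_gauss_arm.
- under eq_integral do rewrite -EFinM normal_pdf_tilt// EFinM.
  rewrite integralZl//; first by rewrite integral_normal_pdf mule1.
  exact: integrable_normal_pdf.
- by move=> x; rewrite lee_fin expR_ge0.
- apply/measurable_EFinP/measurableT_comp => //.
  by apply: measurable_funM => //; exact: measurable_funB.
Qed.

Lemma integrable_normal_mgf m s t : s != 0 ->
  (gauss_arm m s).-integrable setT (EFin \o (fun x => expR (t * (x - m)))).
Proof.
move=> s0; apply/integrableP; split.
  apply/measurable_EFinP/measurableT_comp => //.
  by apply: measurable_funM => //; exact: measurable_funB.
under eq_integral do rewrite /= ger0_norm ?expR_ge0//.
by rewrite normal_mgf// ltry.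
Qed.

Lemma integrable_normal_center m s : s != 0 ->
  (gauss_arm m s).-integrable setT (EFin \o (fun x => x - m)).
Proof.
(* Domination by |y| <= e^y + e^(-y). *)
move=> s0; apply: (@le_integrable _ _ _ _ _ _ _
  (EFin \o (fun x => expR (1 * (x - m)) + expR (-1 * (x - m))))) => //.
- by apply/measurable_EFinP; exact: measurable_funB.
- move=> x _ /=; rewrite lee_fin mul1r mulN1r.
  rewrite [leRHS]ger0_norm ?addr_ge0 ?expR_ge0//.
  have := expR_ge1Dx (x - m); have := expR_ge1Dx (- (x - m)).
  have := expR_ge0 (x - m); have := expR_ge0 (- (x - m)).
  by case: (ger0P (x - m)) => _; lra.
- by apply: integrable_realD; exact: integrable_normal_mgf.
Qed.

(* The mean is read off the moment generating function: 1 + t a <= exp(s^2 t^2 / 2)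
   for all t forces a = 0. *)
Lemma Rintegral_normal_center m s : s != 0 ->
  \int[gauss_arm m s]_x (x - m) = 0.
Proof.
move=> s0; set a := Rintegral _ _ _.
have key t : 1 + t * a <= expR (s ^+ 2 * t ^+ 2 / 2).
  rewrite -[leRHS]/(fine (_ %:E)) -(normal_mgf m)//.
  have -> : 1 + t * a = \int[gauss_arm m s]_x (1 + t * (x - m)).
    rewrite RintegralD//.
    - by rewrite Rintegral_prob_cst RintegralZl//; exact: integrable_normal_center.
    - exact: integrable_real_cst.
    - exact/integrable_realZ/integrable_normal_center.
  apply: le_Rintegral => //.
  - apply: integrable_realD; first exact: integrable_real_cst.
    exact/integrable_realZ/integrable_normal_center.
  - exact: integrable_normal_mgf.
  - by move=> x _; exact: expR_ge1Dx.
have s2 : 0 < s ^+ 2 by rewrite exprn_even_gt0.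
(* For this t one has 0 <= s^2 t^2 <= t a < 1, and [key] with e^u (1 - u) <= 1 gives t a (1 - t a)
   <= 0, hence t a = 0. *)
pose t := a / (s ^+ 2 + a ^+ 2).
have d0 : 0 < s ^+ 2 + a ^+ 2 by rewrite ltr_wpDr// sqr_ge0.
have hE : expR (s ^+ 2 * t ^+ 2 / 2) * (1 - s ^+ 2 * t ^+ 2 / 2) <= 1.
  have := expR_ge1Dx (- (s ^+ 2 * t ^+ 2 / 2)).
  move/(ler_wpM2l (expR_ge0 (s ^+ 2 * t ^+ 2 / 2))).
  by rewrite -expRD subrr expR0.
have ta : t * a = a ^+ 2 / (s ^+ 2 + a ^+ 2) by rewrite /t; field; rewrite gt_eqF.
have ta1 : t * a < 1 by rewrite ta ltr_pdivrMr// mul1r ltrDr.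
have st : s ^+ 2 * t ^+ 2 <= t * a.
  have -> : s ^+ 2 * t ^+ 2 = (t * a) * (s ^+ 2 / (s ^+ 2 + a ^+ 2)).
    by rewrite /t; field; rewrite gt_eqF.
  apply: ler_piMr; first by rewrite ta divr_ge0 ?sqr_ge0// ltW.
  by rewrite ler_pdivrMr// mul1r lerDl sqr_ge0.
have ta0 : 0 <= t * a by rewrite ta divr_ge0 ?sqr_ge0// ltW.
have {}hE : (1 + t * a) * (1 - t * a / 2) <= 1.
  apply: le_trans hE; apply: le_trans (_ : (1 + t * a) * (1 - s ^+ 2 * t ^+ 2 / 2) <= _).
    by apply: ler_wpM2l; lra.
  by apply: ler_wpM2r; [lra|exact: key].
have : (t * a) * (1 - t * a) <= 0 by lra.
rewrite pmulr_lle0 ?subr_gt0// => ta_le0.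
have /eqP : t * a = 0 by apply/eqP; rewrite eq_le ta_le0.
by rewrite ta mulf_eq0 sqrf_eq0 invr_eq0 (gt_eqF d0) orbF => /eqP.
Qed.

Lemma integrable_normal_id m s : s != 0 ->
  (gauss_arm m s).-integrable setT EFin.
Proof.
move=> s0; have := integrable_realD (integrable_normal_center m s0)
  (integrable_real_cst (gauss_arm m s) m).
by apply: eq_integrable => // x _ /=; rewrite subrK.
Qed.

Lemma mean_normal m s : s != 0 -> mean (gauss_arm m s) = m.
Proof.
move=> s0; rewrite /mean -/(Rintegral _ _ _).
have -> : \int[gauss_arm m s]_x x = \int[gauss_arm m s]_x ((x - m) + m).
  by apply: eq_Rintegral => x _; rewrite subrK.
rewrite RintegralD//; last exact: integrable_real_cst.
  by rewrite Rintegral_normal_center// Rintegral_prob_cst add0r.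
exact: integrable_normal_center.
Qed.

Lemma subgaussian_normal m s : s != 0 ->
  subgaussian (gauss_arm m s) (s ^+ 2).
Proof.
move=> s0; split; first exact: integrable_normal_id.
by move=> lam; rewrite mean_normal// normal_mgf.
Qed.

(** Log-likelihood ratio of N(m', s^2) against N(m, s^2). *)
Definition gauss_loglik m m' s x : R := (m' - m) / s ^+ 2 * (x - (m + m') / 2).

Lemma measurable_gauss_loglik m m' s : measurable_fun setT (gauss_loglik m m' s).
Proof. by apply: measurable_funM => //; exact: measurable_funB. Qed.

Lemma ge0_integral_gauss_change m m' s (g : R -> \bar R) : s != 0 ->
    (forall x, 0 <= g x)%E -> measurable_fun setT g ->
  (\int[gauss_arm m' s]_x g x =
   \int[gauss_arm m s]_x (g x * (expR (gauss_loglik m m' s x))%:E))%E.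
Proof.
move=> s0 g0 mg; apply: etrans (ge0_integral_gauss_arm m' s g0 mg) _.
apply: esym; apply: etrans (ge0_integral_gauss_arm m s _ _) _.
- by move=> x; rewrite mule_ge0// lee_fin expR_ge0.
- apply: emeasurable_funM => //; apply/measurable_EFinP/measurableT_comp => //.
  exact: measurable_gauss_loglik.
- by apply: eq_integral => x _; rewrite (normal_pdf_shift m m')// EFinM muleA.
Qed.

Lemma integrable_gauss_change m m' s (g : R -> R) M : s != 0 ->
    (forall x, 0 <= g x <= M) -> measurable_fun setT g ->
  (gauss_arm m s).-integrable setT
    (EFin \o (fun x => g x * expR (gauss_loglik m m' s x))).
Proof.
move=> s0 gM mg; apply/integrableP; split.
  apply/measurable_EFinP/measurable_funM => //; apply: measurableT_comp => //.
  exact: measurable_gauss_loglik.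
have -> : (\int[gauss_arm m s]_x `|(EFin \o (fun x => g x *
    expR (gauss_loglik m m' s x))%R) x| = \int[gauss_arm m' s]_x (g x)%:E)%E.
  apply: esym; apply: etrans (ge0_integral_gauss_change m m' s0 _ _) _.
  - by move=> x; rewrite lee_fin; case/andP: (gM x).
  - exact/measurable_EFinP.
  apply: eq_integral => x _ /=.
  by rewrite ger0_norm// mulr_ge0 ?expR_ge0//; case/andP: (gM x).
have /integrableP[_] : (gauss_arm m' s).-integrable setT (EFin \o g).
  apply: (@integrable_bounded _ _ _ _ _ M) => // x.
  by case/andP: (gM x) => g0 gM'; rewrite ger0_norm.
apply: le_lt_trans; rewrite le_eqVlt; apply/orP; left; apply/eqP.
apply: eq_integral => x _ /=; rewrite ger0_norm//.
by case/andP: (gM x).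
Qed.

Lemma Rintegral_gauss_change m m' s (g : R -> R) : s != 0 ->
    (forall x, 0 <= g x) -> measurable_fun setT g ->
  \int[gauss_arm m' s]_x g x =
  \int[gauss_arm m s]_x (g x * expR (gauss_loglik m m' s x)).
Proof.
move=> s0 g0 mg.
have g0' x : (0 <= (g x)%:E)%E by rewrite lee_fin.
have mg' : measurable_fun setT (fun x => (g x)%:E) by exact/measurable_EFinP.
exact: (congr1 fine (ge0_integral_gauss_change m m' s0 g0' mg')).
Qed.

Lemma integrable_gauss_loglik m m' s : s != 0 ->
  (gauss_arm m s).-integrable setT (EFin \o gauss_loglik m m' s).
Proof.
move=> s0; apply: integrable_realZ; apply: integrable_realD.
  exact: integrable_normal_id.
exact: integrable_real_cst.
Qed.

(** Minus the relative entropy of N(m, s^2) with respect to N(m', s^2): the price of one pull in the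
    change of measure. *)
Lemma Rintegral_gauss_loglik m m' s : s != 0 ->
  \int[gauss_arm m s]_x gauss_loglik m m' s x = - ((m' - m) ^+ 2 / (2 * s ^+ 2)).
Proof.
move=> s0; rewrite /gauss_loglik.
under eq_Rintegral => x _.
  rewrite (_ : x - (m + m') / 2 = (x - m) + (m - m') / 2); last by field.
  over.
have ic := integrable_normal_center m s0.
have icst c := integrable_real_cst (gauss_arm m s) c.
rewrite RintegralZl//; last exact: integrable_realD.
rewrite RintegralD// Rintegral_normal_center// Rintegral_prob_cst.
by field.
Qed.

End GaussianArm.

(** * The stopped process over a bounded number of pulls *)

Section PolicyRun.
Context {R : realType} (n m : nat) (pi : policy R n).
Hypothesis pi_alg : is_algorithm m pi.
Implicit Types (h : seq ('I_n * R)) (c : 'I_n -> R) (f : {set 'I_n} -> R).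
Implicit Types (g : seq ('I_n * R) -> R) (nu : 'I_n -> probability R R).

Lemma policy_ge0 h a : 0 <= pi h a.
Proof. by case: pi_alg. Qed.

Lemma sum_policy h : \sum_(a : Act n) pi h a = 1.
Proof. by case: pi_alg. Qed.

Lemma ler_sum_policy h (F : Act n -> R) M : (forall a, F a <= M) ->
  \sum_(a : Act n) pi h a * F a <= M.
Proof.
move=> FM; rewrite -[leRHS]mul1r -(sum_policy h) mulr_suml.
by apply: ler_sum => a _; rewrite ler_wpM2l// policy_ge0.
Qed.

(** The form of measurability in the last clause of [is_algorithm]; it passes through integration of
    the last reward. *)
Definition measurable_hist g := forall (k : nat) (s : k.-tuple 'I_n),
  measurable_fun setT (fun x : k.-tuple R => g (zip s x)).

Lemma measurable_policy a : measurable_hist (pi ^~ a).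
Proof. by case: pi_alg => _ _ _ mpi k s; exact: mpi. Qed.

Lemma zip_rcons (S T : Type) (s : seq S) (t : seq T) a b : size s = size t ->
  zip (rcons s a) (rcons t b) = rcons (zip s t) (a, b).
Proof.
by elim: s t => [|x s IH] [|y t]//= [st]; rewrite IH.
Qed.

Lemma measurable_rcons_tuple d (S : measurableType d) k (y : S -> k.-tuple R) (x : S -> R) :
  measurable_fun setT y -> measurable_fun setT x ->
  measurable_fun setT (fun p => [tuple of rcons (y p) (x p)]).
Proof.
move=> /measurable_fun_tnthP my mx; apply/measurable_fun_tnthP => j.
have [jk|] := ltnP j k.
  rewrite (_ : _ \o _ = (@tnth k R)^~ (Ordinal jk) \o y)//.
  apply/funext => p /=; rewrite (tnth_nth 0) /= nth_rcons size_tuple jk.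
  by rewrite (tnth_nth 0).
rewrite leq_eqVlt ltnNge -ltnS ltn_ord orbF => /eqP kj.
rewrite (_ : _ \o _ = x)//; apply/funext => p /=.
by rewrite (tnth_nth 0) /= nth_rcons size_tuple -kj ltnn eqxx.
Qed.

Lemma measurable_hist_rcons g h i : measurable_hist g ->
  measurable_fun setT (fun x : R => g (rcons h (i, x))).
Proof.
move=> mg; pose s := [tuple of rcons (map_tuple fst (in_tuple h)) i].
pose y := map_tuple snd (in_tuple h).
rewrite (_ : (fun x => _) = (fun z => g (zip s z)) \o (fun x => [tuple of rcons y x])).
  by apply: (measurableT_comp (mg _ s)); exact: measurable_rcons_tuple.
apply/funext => x /=; rewrite zip_rcons ?size_map//; congr (g (rcons _ _)).
by elim: (h) => //= -[a b] l {1}->.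
Qed.

(** Tonelli: appending a reward is jointly measurable in the past rewards and the new one. *)
Lemma measurable_hist_integral g (P : probability R R) i :
    (forall h, 0 <= g h) -> measurable_hist g ->
  measurable_hist (fun h => \int[P]_x g (rcons h (i, x))).
Proof.
move=> g0 mg k s; rewrite /Rintegral; apply: measurableT_comp => //.
pose G (p : k.-tuple R * R) := (g (rcons (zip s p.1) (i, p.2)))%:E.
apply: (@measurable_fun_fubini_tonelli_F _ _ _ _ _ P G).
  apply/measurable_EFinP; rewrite (_ : (fun p => _) =
    (fun z => g (zip [tuple of rcons s i] z)) \o (fun p : k.-tuple R * R => [tuple of rcons p.1 p.2])).
    by apply: (measurableT_comp (mg _ _)); exact: measurable_rcons_tuple.
  by apply/funext => p /=; rewrite zip_rcons// !size_tuple.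
by move=> p; rewrite lee_fin.
Qed.

(* Total payoff over at most T further pulls: [c i] for every pull of arm i, and [f A] if
   A is returned. *)
Fixpoint val nu c f (T : nat) h {struct T} : R :=
  \sum_(a : Act n) pi h a *
    match a with
    | inr A => f A
    | inl i => match T with
               | 0 => 0
               | T'.+1 => c i + \int[nu i]_x val nu c f T' (rcons h (i, x))
               end
    end.

Lemma valE nu c f T h : val nu c f T h =
  \sum_(i < n) pi h (inl i) *
    (if T is T'.+1 then c i + \int[nu i]_x val nu c f T' (rcons h (i, x)) else 0) +
  \sum_(A : {set 'I_n}) pi h (inr A) * f A.
Proof. by case: T => [|T] /=; rewrite big_sumType. Qed.

Definition unit_payoff (I : Type) (u : I -> R) := forall i, 0 <= u i <= 1.


Definition bounded_hist g M := measurable_hist g /\ forall h, 0 <= g h <= M.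

Lemma bounded_hist_integrable g M (P : probability R R) h i : bounded_hist g M ->
  P.-integrable setT (EFin \o (fun x => g (rcons h (i, x)))).
Proof.
move=> [mg gM]; apply: (@integrable_bounded _ _ _ _ _ M).
  exact: measurable_hist_rcons.
by move=> x; have /andP[g0 ?] := gM (rcons h (i, x)); rewrite ger0_norm.
Qed.

Lemma bounded_hist_Rintegral g M (P : probability R R) h i : bounded_hist g M ->
  0 <= \int[P]_x g (rcons h (i, x)) <= M.
Proof.
move=> ng; apply/andP; split.
  by apply: Rintegral_ge0 => x _; case/andP: (ng.2 (rcons h (i, x))).
rewrite -[leRHS](Rintegral_prob_cst P); apply: le_Rintegral => //.
- exact: bounded_hist_integrable ng.
- exact: integrable_real_cst.
- by move=> x _; case/andP: (ng.2 (rcons h (i, x))).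
Qed.

(** At most T pulls and one return, each paying at most 1. *)
Lemma bounded_hist_val nu c f T : unit_payoff c -> unit_payoff f ->
  bounded_hist (val nu c f T) T.+1%:R.
Proof.
move=> c01 f01; elim: T => [|T IH]; split=> [k s|h].
- under eq_fun do rewrite valE.
  apply: measurable_funD.
    apply: measurable_sum => i; apply: measurable_funM => //.
    exact: measurable_policy.
  apply: measurable_sum => A; apply: measurable_funM => //.
  exact: measurable_policy.
- rewrite /=; apply/andP; split.
    apply: sumr_ge0 => -[i|A] _; rewrite mulr_ge0 ?policy_ge0//.
    by case/andP: (f01 A).
  by apply: ler_sum_policy => -[//|A]; case/andP: (f01 A).
- under eq_fun do rewrite valE.
  apply: measurable_funD; apply: measurable_sum => i; apply: measurable_funM => //;
    try exact: measurable_policy.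
  apply: measurable_funD => //.
  apply: (@measurable_hist_integral (val nu c f T) (nu i) i _ _ k s); last by case: IH.
  by move=> h; case: IH => _ /(_ h)/andP[].
- rewrite /=; apply/andP; split.
    apply: sumr_ge0 => -[i|A] _; rewrite mulr_ge0 ?policy_ge0//.
      rewrite addr_ge0//; first by case/andP: (c01 i).
      by case/andP: (bounded_hist_Rintegral (nu i) h i IH).
    by case/andP: (f01 A).
  apply: ler_sum_policy => -[i|A].
    rewrite -[T.+2%:R]natr1 [leRHS]addrC lerD//; first by case/andP: (c01 i).
    by case/andP: (bounded_hist_Rintegral (nu i) h i IH).
  by case/andP: (f01 A) => _ /le_trans; apply; rewrite ler1n.
Qed.

Lemma unit_payoff0 (I : Type) : unit_payoff (fun=> 0 : R) (I := I).
Proof. by move=> i; rewrite lexx ler01. Qed.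

Lemma unit_payoff1 (I : Type) : unit_payoff (fun=> 1 : R) (I := I).
Proof. by move=> i; rewrite lexx ler01. Qed.

Arguments unit_payoff0 : clear implicits.
Arguments unit_payoff1 : clear implicits.

Lemma unit_payoffb (I : Type) (b : I -> bool) : unit_payoff (fun i => (b i)%:R).
Proof. by move=> i; case: (b i); rewrite ?lexx ?ler01. Qed.

Lemma val_ge0 nu c f T h : unit_payoff c -> unit_payoff f -> 0 <= val nu c f T h.
Proof. by move=> c01 f01; have [_ /(_ h)/andP[]] := bounded_hist_val nu T c01 f01. Qed.

Lemma bounded_hist_val1 nu f T : unit_payoff f -> bounded_hist (val nu (fun=> 0) f T) 1.
Proof.
move=> f01; split=> [|h]; first by have [] := bounded_hist_val nu T (unit_payoff0 _) f01.
rewrite val_ge0//=; last exact: unit_payoff0.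
elim: T h => [|T IH] h /=.
  by apply: ler_sum_policy => -[i|A]; rewrite ?ler01//; case/andP: (f01 A).
apply: ler_sum_policy => -[i|A]; last by case/andP: (f01 A).
have /andP[_] := bounded_hist_Rintegral (nu i) h i (bounded_hist_val nu T (unit_payoff0 _) f01).
rewrite add0r => _; rewrite -[leRHS](Rintegral_prob_cst (nu i)).
apply: le_Rintegral => //.
- exact: bounded_hist_integrable (bounded_hist_val nu T (unit_payoff0 _) f01).
- exact: integrable_real_cst.
Qed.

Lemma val_nondecreasing nu f T T' h : unit_payoff f -> (T <= T')%N ->
  val nu (fun=> 0) f T h <= val nu (fun=> 0) f T' h.
Proof.
move=> f01 TT'; elim: T T' TT' h => [|T IH] [|T'] // TT' h; rewrite !valE;
  rewrite lerD2r; apply: ler_sum => i _; rewrite ler_wpM2l ?policy_ge0// add0r.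
  by case/andP: (bounded_hist_Rintegral (nu i) h i (bounded_hist_val1 nu T' f01)).
rewrite add0r; apply: le_Rintegral => //.
- exact: bounded_hist_integrable (bounded_hist_val1 nu T f01).
- exact: bounded_hist_integrable (bounded_hist_val1 nu T' f01).
- by move=> x _; exact: IH.
Qed.

Lemma run_val nu f T h : unit_payoff f ->
  run pi nu (fun A => (f A)%:E) T h = (val nu (fun=> 0) f T h)%:E.
Proof.
move=> f01; elim: T h => [|T IH] h /=.
  by rewrite -sumEFin; apply: eq_bigr => -[i|A] _; rewrite EFinM.
rewrite -sumEFin; apply: eq_bigr => -[i|A] _; rewrite EFinM//; congr *%E.
rewrite add0r; under eq_integral do rewrite IH.
rewrite fineK//; apply: integrable_fin_num => //.
exact: bounded_hist_integrable (bounded_hist_val1 nu T f01).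
Qed.

Lemma Rintegral_sum (I : finType) (P : probability R R) (u : I -> R -> R) (b : I -> R) :
    (forall i, P.-integrable setT (EFin \o u i)) ->
  \int[P]_x (\sum_i b i * u i x) = \sum_i b i * \int[P]_x u i x /\
  P.-integrable setT (EFin \o (fun x => \sum_i b i * u i x)).
Proof.
move=> iu; elim: (index_enum I) => [|i r [IH1 IH2]].
  split; first by under eq_Rintegral do rewrite big_nil; rewrite big_nil Rintegral_prob_cst.
  under eq_fun do rewrite big_nil.
  exact: integrable_real_cst.
have E : (fun x => \sum_(j <- i :: r) b j * u j x) =
    (fun x => b i * u i x + \sum_(j <- r) b j * u j x).
  by apply/funext => x; rewrite big_cons.
split; last by rewrite E; apply: integrable_realD => //; exact: integrable_realZ.
rewrite E big_cons RintegralD//; last exact: integrable_realZ.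
by rewrite RintegralZl// IH1.
Qed.

Definition pulls nu i T h := val nu (fun j => (j == i)%:R) (fun=> 0) T h.
Definition returns nu A T h := val nu (fun=> 0) (fun B => (B == A)%:R) T h.

Lemma bounded_hist_pulls nu i T : bounded_hist (pulls nu i T) T.+1%:R.
Proof. by apply: bounded_hist_val; [exact: unit_payoffb|exact: unit_payoff0]. Qed.

Lemma bounded_hist_returns nu A T : bounded_hist (returns nu A T) 1.
Proof. by apply: bounded_hist_val1; exact: unit_payoffb. Qed.

(** The payoff is linear in (c, f), so it is determined by the expected numbers of pulls and the
    probabilities of the returned sets. *)
Lemma val_linear nu c f T h :
  val nu c f T h = \sum_i c i * pulls nu i T h + \sum_A f A * returns nu A T h.
Proof.
have delta (I : finType) (F : I -> R) j : F j = \sum_i F i * (j == i)%:R.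
  rewrite (bigD1 j)//= eqxx mulr1 big1 ?addr0// => i /negbTE.
  by rewrite eq_sym => ->; rewrite mulr0.
have zero (I : finType) (F : I -> R) : \sum_i F i * 0 = 0.
  by rewrite big1// => i _; rewrite mulr0.
have step (p Y : Act n -> R) (Yp : 'I_n -> Act n -> R)
    (Yr : {set 'I_n} -> Act n -> R) :
    (forall a, Y a = \sum_i c i * Yp i a + \sum_A f A * Yr A a) ->
    \sum_a p a * Y a =
    \sum_i c i * (\sum_a p a * Yp i a) + \sum_A f A * (\sum_a p a * Yr A a).
  move=> YE; under eq_bigr do rewrite YE mulrDr !mulr_sumr.
  rewrite big_split exchange_big/= [X in _ + X]exchange_big/=.
  by congr +%R; apply: eq_bigr => i _; rewrite mulr_sumr; apply: eq_bigr => a _;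
    rewrite mulrCA.
elim: T h => [|T IH] h; apply: step => -[i|A] //=.
- by rewrite !zero addr0.
- by rewrite zero add0r -delta.
- have [Ep ip] := Rintegral_sum c
    (fun j => bounded_hist_integrable (nu i) h i (bounded_hist_pulls nu j T)).
  have [Er ir] := Rintegral_sum f
    (fun A => bounded_hist_integrable (nu i) h i (bounded_hist_returns nu A T)).
  rewrite (eq_Rintegral _ (fun x _ => IH (rcons h (i, x)))).
  rewrite RintegralD// Ep Er; under [in RHS]eq_bigr do rewrite mulrDr.
  rewrite big_split/= -delta -addrA; congr (_ + (_ + _)).
  by apply: eq_bigr => A _; rewrite add0r.
- by rewrite zero add0r -delta.
Qed.

(** With tau the number of pulls, this reads E[min(tau, T + 1)] = E[min(tau, T)] + P(tau > T). *)
Lemma duration_recS nu T h :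
  val nu (fun=> 1) (fun=> 0) T.+1 h =
  val nu (fun=> 1) (fun=> 0) T h + (1 - val nu (fun=> 0) (fun=> 1) T h).
Proof.
have step (p Y Y1 Y2 : Act n -> R) : \sum_a p a = 1 ->
    (forall a, Y a = Y1 a + (1 - Y2 a)) ->
    \sum_a p a * Y a = \sum_a p a * Y1 a + (1 - \sum_a p a * Y2 a).
  move=> p1 YE; under eq_bigr do rewrite YE mulrDr mulrBr mulr1.
  by rewrite big_split/= sumrB p1.
elim: T h => [|T IH] h; apply: step (sum_policy h) _ => -[i|A].
- by rewrite subr0 add0r /= -[RHS]addr0; congr +%R; rewrite -[RHS](Rintegral_prob_cst (nu i));
    apply: eq_Rintegral => x _; rewrite big1// => -[?|?] _; rewrite mulr0.
- by rewrite subrr addr0.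
- have n1 T' := bounded_hist_val nu T' (unit_payoff1 _) (unit_payoff0 _).
  have n2 := bounded_hist_val1 nu T (unit_payoff1 _).
  rewrite add0r -addrA; congr (_ + _); rewrite (eq_Rintegral _ (fun x _ => IH (rcons h (i, x)))).
  have i1 := bounded_hist_integrable (nu i) h i (n1 T).
  have i2 := bounded_hist_integrable (nu i) h i n2.
  have icst := integrable_real_cst (nu i) 1.
  rewrite RintegralD//; last first.
    have := integrable_realZ (-1) i2 => i2'.
    have := integrable_realD icst i2'.
    by apply: eq_integrable => // x _ /=; rewrite mulN1r.
  by rewrite RintegralB// Rintegral_prob_cst.
- by rewrite subrr addr0.
Qed.

Lemma val_le_expected_samples nu T :
  ((val nu (fun=> 1) (fun=> 0) T [::])%:E <= expected_samples pi nu)%E.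
Proof.
have runE t : (1 - run pi nu (fun=> 1) t [::] = (1 - val nu (fun=> 0) (fun=> 1) t [::])%:E)%E.
  by rewrite (run_val nu t [::] (unit_payoff1 _)) EFinB.
(* The recursion telescopes to a partial sum of the series defining [expected_samples]. *)
have -> : ((val nu (fun=> 1%R) (fun=> 0%R) T [::])%:E =
    \sum_(0 <= t < T) (1 - run pi nu (fun=> 1) t [::]))%E.
  elim: T => [|T IH].
    by rewrite big_nil /= big1// => -[?|?] _; rewrite mulr0.
  by rewrite big_nat_recr//= -IH runE -EFinD -duration_recS.
apply: nneseries_lim_ge => t _ _; rewrite runE lee_fin subr_ge0.
by have [_ /(_ [::])/andP[]] := bounded_hist_val1 nu t (unit_payoff1 _).
Qed.

Lemma sum_pulls_le_expected_samples nu T :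
  ((\sum_i pulls nu i T [::])%:E <= expected_samples pi nu)%E.
Proof.
apply: le_trans (val_le_expected_samples nu T); rewrite lee_fin val_linear.
rewrite [X in _ + X]big1 ?addr0 => [|A _]; last by rewrite mul0r.
by apply: ler_sum => i _; rewrite mul1r.
Qed.

End PolicyRun.

(** * Change of measure when the law of one arm moves *)

Lemma le_Rintegral_comb (R : realType) d (T : measurableType d) (P : probability T R)
    (u1 u2 u3 u4 u5 : T -> R) (c1 c2 c3 c4 c5 k I1 I2 I3 I4 I5 : R) :
    P.-integrable setT (EFin \o u1) -> P.-integrable setT (EFin \o u2) ->
    P.-integrable setT (EFin \o u3) -> P.-integrable setT (EFin \o u4) ->
    P.-integrable setT (EFin \o u5) ->
    \int[P]_x u1 x = I1 -> \int[P]_x u2 x = I2 -> \int[P]_x u3 x = I3 ->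
    \int[P]_x u4 x = I4 -> \int[P]_x u5 x = I5 ->
    (forall x, c1 * u1 x + (c2 * u2 x + (c3 * u3 x + (c4 * u4 x + c5 * u5 x))) <= k) ->
  c1 * I1 + (c2 * I2 + (c3 * I3 + (c4 * I4 + c5 * I5))) <= k.
Proof.
move=> i1 i2 i3 i4 i5 <- <- <- <- <- uk; have Z c u := @integrable_realZ _ _ _ P c u.
have i45 := integrable_realD (Z c4 _ i4) (Z c5 _ i5).
have i35 := integrable_realD (Z c3 _ i3) i45.
have i25 := integrable_realD (Z c2 _ i2) i35.
rewrite -!RintegralZl// -!RintegralD//; [|exact: Z..].
rewrite -[leRHS](Rintegral_prob_cst P); apply: le_Rintegral => //.
- by apply: integrable_realD => //; exact: Z.
- exact: integrable_real_cst.
Qed.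

Lemma imply_elim (A B C : Prop) : A -> (B -> C) -> (A -> B) -> C.
Proof. by move=> a bc ab; exact/bc/ab. Qed.

(** Arithmetic at a pull of the changed arm: x is the likelihood ratio of the reward and l its
    logarithm, so the weight w becomes w x. *)
Lemma tilted_step (R : realType) (t w e k v v' p x l lw : R) :
  t * v - w * x * (1 + e * v') <= - (lw + l) - 1 + k * p ->
  t * v + (- (w * e) * (v' * x) + (- k * p + (- w * (1 * x) + 1 * l))) <= - lw - 1.
Proof. by lra. Qed.

(** The same after integration: the ratio has mean 1 and its logarithm mean - k, which pays for the
    extra pull in 1 + p. *)
Lemma tilted_sum (R : realType) (t w e k v v' p lw : R) :
  t * v + (- (w * e) * v' + (- k * p + (- w * 1 + 1 * - k))) <= - lw - 1 ->
  t * v - w * (1 + e * v') <= - lw - 1 + k * (1 + p).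
Proof. by lra. Qed.

Section ChangeOfMeasure.
Context {R : realType} (n m : nat) (pi : policy R n).
Hypothesis pi_alg : is_algorithm m pi.
Variables (nu nu' : 'I_n -> probability R R) (i0 : 'I_n) (a a' s : R).
Hypotheses (s0 : s != 0) (nu_i0 : nu i0 = gauss_arm a s)
  (nu'_i0 : nu' i0 = gauss_arm a' s) (nu_nu' : forall j, j != i0 -> nu j = nu' j).
Variable E : {set 'I_n} -> bool.
Local Notation Eind := (fun A => (E A)%:R : R).
Local Notation V := (val pi nu (fun=> 0) Eind).
Local Notation V' := (val pi nu' (fun=> 0) Eind).
Local Notation N := (pulls pi nu i0).
Local Notation K := ((a' - a) ^+ 2 / (2 * s ^+ 2)).

Lemma ln_le_subr1 (w : R) : 0 < w -> ln w <= w - 1.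
Proof.
move=> w0; have := @le_ln1Dx R (w - 1).
by rewrite (addrC 1) subrK => -> //; rewrite ltrBrDr addrC subrr.
Qed.

(* Variational form of the data processing inequality for the relative entropy: a weight [w]
   stands for the likelihood ratio of the history, and minimising over [w] would give
   [t V <= ln (1 + (e^t - 1) V') + K N]. *)
Lemma change_of_measure_aux t w T h : 0 <= t -> 0 < w ->
  t * V T h - w * (1 + (expR t - 1) * V' T h) <= - ln w - 1 + K * N T h.
Proof.
move=> t0 w0; have [e e0 eE] : exists2 e, 0 <= e & expR t - 1 = e.
  by exists (expR t - 1) => //; rewrite subr_ge0 -expR0 ler_expR.
have step w' (p Y Y1 Y2 : Act n -> R) : \sum_b p b = 1 -> (forall b, 0 <= p b) ->
    (forall b, t * Y b - w' * (1 + e * Y1 b) <= - ln w' - 1 + K * Y2 b) ->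
    t * (\sum_b p b * Y b) - w' * (1 + e * (\sum_b p b * Y1 b)) <=
    - ln w' - 1 + K * (\sum_b p b * Y2 b).
  move=> p1 p0 YE.
  have : \sum_b p b * (t * Y b + (- (w' * e) * Y1 b + (- K * Y2 b + (ln w' + 1 - w')))) <= 0.
    apply: sumr_le0 => b _; rewrite mulr_ge0_le0//; have := YE b; lra.
  under eq_bigr do rewrite !mulrDr (mulrCA _ t) (mulrCA _ (- _)) (mulrCA _ (- K)).
  rewrite !big_split/= -!mulr_sumr -!mulr_suml p1; lra.
(* Once the run has ended the claim is ln y <= y - 1, at y = w' e^t if the event holds and at y = w'
   otherwise. *)
have base (b : bool) w' : 0 < w' -> t * b%:R - w' * (1 + e * b%:R) <= - ln w' - 1.
  move=> {}w0; case: b; rewrite ?mulr1n ?mulr0n ?mulr1 ?mulr0 ?addr0.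
    have := ln_le_subr1 (mulr_gt0 w0 (expR_gt0 t)); rewrite lnM ?posrE ?expR_gt0// expRK.
    have -> : expR t = e + 1 by lra.
    lra.
  by have := ln_le_subr1 w0; lra.
rewrite {}eE; elim: T w w0 h => [|T IH] w w0 h; apply: step (sum_policy pi_alg h) (policy_ge0 pi_alg h) _ => -[i|A].
- by have := base false _ w0; rewrite mulr0n !mulr0; lra.
- by have := base (E A) _ w0; rewrite mulr0; lra.
- have nV := bounded_hist_integrable (nu i) h i (bounded_hist_val1 pi_alg nu T (unit_payoffb E)).
  have nV'1 := bounded_hist_val1 pi_alg nu' T (unit_payoffb E).
  have nV' := bounded_hist_integrable (nu i) h i nV'1.
  have nN := bounded_hist_integrable (nu i) h i (bounded_hist_pulls pi_alg nu i0 T).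
  (* A pull of another arm keeps the weight; a pull of [i0] multiplies it by the likelihood ratio of
     the reward. *)
  rewrite !add0r; have [ii0|ii0] := eqVneq i i0; last first.
    rewrite add0r -(nu_nu' ii0).
    have i0' := integrable_real_cst (nu i) 0.
    have := le_Rintegral_comb (c1 := t) (c2 := - (w * e)) (c3 := - K) (c4 := 0) (c5 := 0)
      (k := w - ln w - 1) nV nV' nN i0' i0'
      erefl erefl erefl erefl erefl.
    rewrite !mul0r !addr0; apply: imply_elim => [x|].
      by have := IH w w0 (rcons h (i, x)); lra.
    lra.
  rewrite ii0 in nV nN *; rewrite nu'_i0 nu_i0 in nV nN *.
  have mV' : measurable_fun setT (fun x => V' T (rcons h (i0, x))).
    by apply: measurable_hist_rcons; case: nV'1.
  have V'01 x : 0 <= V' T (rcons h (i0, x)) <= 1 by case: nV'1 => _; apply.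
  have V'0 x : 0 <= V' T (rcons h (i0, x)) by case/andP: (V'01 x).
  have lnwE l : ln (w * expR l) = ln w + l by rewrite lnM ?posrE ?expR_gt0// expRK.
  pose one : R -> R := fun=> 1.
  have mone : measurable_fun setT one by exact: measurable_cst.
  have one01 x : 0 <= one x <= 1 by rewrite /one ler01 lexx.
  have one0 x : 0 <= one x by exact: ler01.
  have e2 := esym (Rintegral_gauss_change a a' s0 V'0 mV').
  have e4 := etrans (esym (Rintegral_gauss_change a a' s0 one0 mone)) (Rintegral_prob_cst _ 1).
  have e5 := Rintegral_gauss_loglik a a' s0.
  have i2 := integrable_gauss_change a a' s0 V'01 mV'.
  have i4 := integrable_gauss_change a a' s0 one01 mone.
  have i5 := integrable_gauss_loglik a a' s0.
  (* The five integrands are V, V' times the likelihood ratio, N, the ratio itself and its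
     logarithm. *)
  have := @le_Rintegral_comb R _ _ _ _ _ _ _ _ t (- (w * e)) (- K) (- w) 1 (- ln w - 1) _ _ _ _ _ nV i2 nN i4 i5.
  move/(_ _ _ _ _ _ erefl e2 erefl e4 e5).
  apply: imply_elim => [x|].
    have := IH (w * expR (gauss_loglik a a' s x)) (mulr_gt0 w0 (expR_gt0 _)) (rcons h (i0, x)).
    by rewrite lnwE; exact: tilted_step.
  by rewrite mulr1n; exact: tilted_sum.
- by have := base (E A) _ w0; rewrite mulr0; lra.
Qed.

Lemma change_of_measure t T h : 0 <= t ->
  t * V T h <= (expR t - 1) * V' T h + K * N T h.
Proof.
by move=> t0; have := change_of_measure_aux T h t0 ltr01; rewrite ln1; lra.
Qed.


End ChangeOfMeasure.

(** * Gaussian instances with three levels of means *)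

Lemma le_mth_largest (R : realType) (n m : nat) (mu : 'I_n -> R) (v : R) :
  (0 < m)%N -> (m <= #|[set i | (v <= mu i)%R]|)%N -> v <= mth_largest mu m.
Proof.
move=> m0; apply: contraTT; rewrite -ltNge -ltnNge /mth_largest => lt_v.
set s := [seq mu i | i <- enum 'I_n] in lt_v *.
have -> : #|[set i | (v <= mu i)%R]| = count (fun x => (v <= x)%R) (sort (fun x y => (y <= x)%R) s).
  rewrite (permP (permEl (perm_sort _ s))) count_map enumT cardE size_filter.
  by apply: eq_count => i; rewrite -[LHS]/(i \in _) inE.
set r := sort _ s in lt_v *.
have sr : sorted (fun x y : R => y <= x) r by apply: sort_sorted => x y; exact: le_total.
(* The sort is decreasing, so everything from index m - 1 on is below v and at most m - 1 entries
   reach v. *)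
rewrite -(cat_take_drop m.-1 r) count_cat.
have -> : count (fun x => (v <= x)%R) (drop m.-1 r) = 0%N.
  apply/eqP; rewrite -leqn0 leqNgt -has_count; apply/hasPn => x /(nthP 0)[j].
  rewrite size_drop => jr <-; rewrite -ltNge nth_drop; apply: le_lt_trans lt_v.
  apply: (sorted_leq_nth (leT := fun x y : R => y <= x)) => //.
  - by move=> y x' z xy yz; exact: le_trans yz xy.
  - by rewrite inE; apply: leq_ltn_trans (leq_addr j _) _; rewrite -ltn_subRL.
  - by rewrite inE -ltn_subRL.
  - exact: leq_addr.
rewrite addn0 -[X in (_ < X)%N](prednK m0) ltnS (leq_trans (count_size _ _))//.
by rewrite size_take_min geq_minl.
Qed.

Section GaussianInstances.
Context {R : realType} (n m : nat) (eps delta : R) (sigma2 : 'I_n -> R).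
Variable pi : policy R n.
Hypotheses (eps0 : 0 < eps) (m0 : (0 < m)%N).
Hypotheses (sigma2_gt0 : forall i, 0 < sigma2 i) (pi_alg : is_algorithm m pi).
Implicit Types (H L A S : {set 'I_n}).

(** Levels 2 eps, 0 and - 2 eps lie farther apart than the tolerance eps, and adding one arm to H or
    to L moves its mean by exactly 2 eps. *)
Definition two_level_mean H L (i : 'I_n) : R :=
  2 * eps * ((i \in H)%:R - (i \in L)%:R).

Definition two_level_bandit H L (i : 'I_n) : probability R R :=
  gauss_arm (two_level_mean H L i) (Num.sqrt (sigma2 i)).

Lemma sqrt_sigma2_neq0 i : Num.sqrt (sigma2 i) != 0.
Proof. by rewrite gt_eqF// sqrtr_gt0. Qed.

Lemma two_level_instance H L : instance_of sigma2 (two_level_bandit H L).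
Proof.
move=> i; rewrite -[sigma2 i]sqr_sqrtr ?ltW//.
exact/subgaussian_normal/sqrt_sigma2_neq0.
Qed.

(** The m arms of H reach 2 eps, so an acceptable arm has mean at least eps, which forces it into
    H. *)
Lemma good_set_top H A : #|H| = m -> #|A| = m ->
  good_set m eps (two_level_mean H finset.set0) A = true -> A = H.
Proof.
move=> Hm Am /forall_inP gA; apply/eqP; rewrite eqEcard Hm Am leqnn andbT.
apply/fintype.subsetP => i /gA; have : 2 * eps <= mth_largest (two_level_mean H finset.set0) m.
  apply: le_mth_largest => //; rewrite -Hm; apply/subset_leq_card/fintype.subsetP => j jH.
  by rewrite inE /two_level_mean jH finset.in_set0 subr0 mulr1.
rewrite {3}/two_level_mean finset.in_set0; case: (i \in H) => //; rewrite subr0 mulr0.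
by move: eps0; lra.
Qed.

(** At least m arms other than i have mean at least 0, so the threshold is at least - eps, above the
    mean - 2 eps of i. *)
Lemma good_set_low S A i : (m < n)%N -> i \notin S ->
  good_set m eps (two_level_mean S [set i]) A -> i \notin A.
Proof.
move=> mn iS /forall_inP gA; apply/negP => /gA.
have : 0 <= mth_largest (two_level_mean S [set i]) m.
  apply: le_mth_largest => //; have : (m <= #|~: [set i]|)%N.
    by rewrite cardsC1 card_ord; lia.
  move=> /leq_trans; apply; apply/subset_leq_card/fintype.subsetP => j.
  rewrite !inE /two_level_mean inE => /negbTE ->.
  by rewrite subr0 mulr_ge0 ?ler0n// mulr_ge0// ltW.
rewrite {3}/two_level_mean (negbTE iS) inE eqxx sub0r mulrN1.
by move: eps0; lra.
Qed.

Lemma val_returns nu T h (E : {set 'I_n} -> bool) :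
  val pi nu (fun=> 0) (fun A => (E A)%:R) T h = \sum_(A | E A) returns pi nu A T h.
Proof.
rewrite (val_linear pi_alg)/= [X in X + _]big1 => [|i _]; last by rewrite mul0r.
rewrite add0r [RHS]big_mkcond/=; apply: eq_bigr => A _.
by case: (E A); rewrite ?mul1r ?mul0r.
Qed.

Lemma sum_returns_le1 nu T h (E : {set 'I_n} -> bool) :
  \sum_(A | E A) returns pi nu A T h <= 1.
Proof.
rewrite -val_returns; have [_ /(_ h)/andP[]//] := bounded_hist_val1 pi_alg nu T (unit_payoffb E).
Qed.

Lemma returns_ge0 nu A T h : 0 <= returns pi nu A T h.
Proof. by have [_ /(_ h)/andP[]] := bounded_hist_returns pi_alg nu A T. Qed.

Lemma returns_card nu A T h : #|A| != m -> returns pi nu A T h = 0.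
Proof.
move=> Am; have piA h' : pi h' (inr A) = 0 by case: pi_alg => _ _ /(_ h' A Am).
rewrite /returns; elim: T h => [|T IH] h; rewrite valE.
  rewrite big1 ?add0r => [|i _]; last by rewrite mulr0.
  rewrite (bigD1 A)//= piA mul0r add0r big1// => B /negbTE ->; by rewrite mulr0.
rewrite big1 ?add0r => [|i _].
  rewrite (bigD1 A)//= piA mul0r add0r big1// => B /negbTE ->; by rewrite mulr0.
by rewrite add0r (eq_Rintegral _ (fun x _ => IH (rcons h (i, x)))) Rintegral_prob_cst mulr0.
Qed.

Hypothesis delta0 : 0 < delta.

(** [prob_correct] is a supremum over horizons: giving up delta / 100 makes a finite horizon
    suffice, and the finitely many pairs (H, L) share the largest one. *)
Lemma exists_horizon : solves m eps delta sigma2 pi ->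
  exists T, forall H L, 1 - 101 / 100 * delta <=
    \sum_(A | good_set m eps (two_level_mean H L) A) returns pi (two_level_bandit H L) A T [::].
Proof.
move=> slv; pose G H L A := good_set m eps (two_level_mean H L) A.
pose V H L T := val pi (two_level_bandit H L) (fun=> 0) (fun A => (G H L A)%:R) T [::].
have ex (p : {set 'I_n} * {set 'I_n}) : exists T, 1 - 101 / 100 * delta <= V p.1 p.2 T.
  case: p => H L /=; have := slv _ (two_level_instance H L); rewrite /prob_correct.
  have lt_d : ((1 - 101 / 100 * delta)%:E < (1 - delta)%:E :> \bar R)%E.
    by rewrite lte_fin; move: delta0; lra.
  move=> /(lt_le_trans lt_d) /ereal_sup_gt[_ [T _ <-]] /ltW runT.
  exists T; rewrite -lee_fin (le_trans runT)// /V -(run_val pi_alg)//; last exact: unit_payoffb.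
  rewrite le_eqVlt; apply/orP; left; apply/eqP; congr (run _ _ _ _ _); apply/funext => A.
  rewrite /G; have -> : (fun i => mean (two_level_bandit H L i)) = two_level_mean H L.
    by apply/funext => i; rewrite mean_normal// sqrt_sigma2_neq0.
  by case: good_set.
have [Tf TfP] := choice ex; exists (\max_p Tf p)%N => H L.
rewrite -val_returns (le_trans (TfP (H, L)))// (val_nondecreasing pi_alg)//.
  exact: unit_payoffb.
exact: (leq_bigmax (H, L)).
Qed.

(** Everything the lower bound uses about the algorithm, as finitely many reals free of measure
    theory. The factor 2 eps^2 / sigma_i^2 is the relative entropy for a mean shift of 2 eps. *)
Record two_level_stats (B : R) := TwoLevelStats {
  ret : {set 'I_n} -> {set 'I_n} -> {set 'I_n} -> R;
  pull : {set 'I_n} -> {set 'I_n} -> 'I_n -> R;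
  ret_ge0 : forall H L A, 0 <= ret H L A;
  sum_ret_le1 : forall H L (E : {set 'I_n} -> bool), \sum_(A | E A) ret H L A <= 1;
  ret_card : forall H L A, #|A| != m -> ret H L A = 0;
  ret_good : forall H L, 1 - 101 / 100 * delta <=
    \sum_(A | good_set m eps (two_level_mean H L) A) ret H L A;
  pull_ge0 : forall H L i, 0 <= pull H L i;
  sum_pull_le : forall H L, \sum_i pull H L i <= B;
  ret_raise : forall H L i (E : {set 'I_n} -> bool) t, 0 <= t -> i \notin H ->
    t * \sum_(A | E A) ret H L A <= (expR t - 1) * \sum_(A | E A) ret (i |: H) L A
      + 2 * eps ^+ 2 / sigma2 i * pull H L i;
  ret_lower : forall H L i (E : {set 'I_n} -> bool) t, 0 <= t -> i \notin L ->
    t * \sum_(A | E A) ret H L A <= (expR t - 1) * \sum_(A | E A) ret H (i |: L) A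
      + 2 * eps ^+ 2 / sigma2 i * pull H L i }.

Lemma exists_two_level_stats B : solves m eps delta sigma2 pi ->
    (forall nu, instance_of sigma2 nu -> (expected_samples pi nu <= B%:E)%E) ->
  exists _ : two_level_stats B, True.
Proof.
move=> slv leB; have [T TP] := exists_horizon slv.
have com nu nu' i a a' (E : {set 'I_n} -> bool) t : 0 <= t -> (a' - a) ^+ 2 = (2 * eps) ^+ 2 ->
    nu i = gauss_arm a (Num.sqrt (sigma2 i)) -> nu' i = gauss_arm a' (Num.sqrt (sigma2 i)) ->
    (forall j, j != i -> nu j = nu' j) ->
    t * \sum_(A | E A) returns pi nu A T [::] <=
    (expR t - 1) * \sum_(A | E A) returns pi nu' A T [::]
      + 2 * eps ^+ 2 / sigma2 i * pulls pi nu i T [::].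
  move=> t0 aa nui nu'i nn.
  have := change_of_measure pi_alg (sqrt_sigma2_neq0 i) nui nu'i nn E T [::] t0.
  rewrite -!val_returns sqr_sqrtr ?(ltW (sigma2_gt0 i))// aa.
  have -> // : (2 * eps) ^+ 2 / (2 * sigma2 i) = 2 * eps ^+ 2 / sigma2 i.
  by field; rewrite gt_eqF.
unshelve eexists (@TwoLevelStats B
  (fun H L A => returns pi (two_level_bandit H L) A T [::])
  (fun H L i => pulls pi (two_level_bandit H L) i T [::]) _ _ _ _ _ _ _ _) => //.
- by move=> *; exact: returns_ge0.
- by move=> *; exact: sum_returns_le1.
- by move=> *; exact: returns_card.
- by move=> H L i; have [_ /(_ [::])/andP[]] := bounded_hist_pulls pi_alg (two_level_bandit H L) i T.
- move=> H L; rewrite -lee_fin.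
  apply: le_trans (leB _ (two_level_instance H L)).
  exact: (sum_pulls_le_expected_samples pi_alg).
- move=> H L i E t t0 iH.
  apply: (com _ _ i (two_level_mean H L i) (two_level_mean (i |: H) L i) E t t0 _
    (erefl _) (erefl _)).
  + by rewrite /two_level_mean finset.in_setU1 eqxx (negbTE iH)/=; ring.
  + by move=> j ji; rewrite /two_level_bandit /two_level_mean finset.in_setU1 (negbTE ji).
- move=> H L i E t t0 iL.
  apply: (com _ _ i (two_level_mean H L i) (two_level_mean H (i |: L) i) E t t0 _
    (erefl _) (erefl _)).
  + by rewrite /two_level_mean finset.in_setU1 eqxx (negbTE iL)/=; ring.
  + by move=> j ji; rewrite /two_level_bandit /two_level_mean finset.in_setU1 (negbTE ji).
Qed.

End GaussianInstances.

(** * The term with ln (1 / delta) *)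

Lemma exists_light_subset (R : realFieldType) (n k : nat) (w : 'I_n -> R) :
    (2 * k <= n)%N -> (forall i, 0 <= w i) ->
  exists2 S : {set 'I_n}, #|S| = k & \sum_(i in S) w i <= (\sum_i w i) / 2.
Proof.
move=> kn w0; pose e := enum 'I_n; have ue : uniq e := enum_uniq _.
(* Of two disjoint sets of size k, the lighter one carries at most half of the total. *)
pose S1 := [set i in take k e]; pose S2 := [set i in take k (drop k e)].
have se : size e = n by rewrite size_enum_ord.
have c1 : #|S1| = k.
  rewrite cardsE; have /card_uniqP -> := take_uniq k ue.
  by rewrite size_takel// se; lia.
have c2 : #|S2| = k.
  rewrite cardsE; have /card_uniqP -> := take_uniq k (drop_uniq k ue).
  by rewrite size_takel// size_drop se; lia.
have dis : [disjoint S1 & S2].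
  apply/pred0P => i /=; rewrite !inE; apply/negP => /andP[i1 /mem_take i2].
  move: ue; rewrite -(cat_take_drop k e) cat_uniq => /and3P[_ /hasPn/(_ _ i2)].
  by rewrite /= i1.
have : \sum_(i in S1) w i + \sum_(i in S2) w i <= \sum_i w i.
  rewrite big_mkcond [X in _ + X]big_mkcond -big_split/=; apply: ler_sum => i _.
  have := pred0P dis i; rewrite /=.
  by case: (i \in S1); case: (i \in S2); rewrite ?addr0 ?add0r.
have [le1 _|gt1 le12] := lerP (\sum_(i in S1) w i) ((\sum_i w i) / 2); first by exists S1.
by exists S2 => //; move: gt1 le12; lra.
Qed.

Lemma expR1_ge (R : realType) : 5 / 2 <= expR 1 :> R.
Proof.
have e8 : 9 / 8 <= expR (1 / 8) :> R by have := @expR_ge1Dx R (1 / 8); lra.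
have -> : expR 1 = expR (1 / 8) ^+ 8 :> R.
  by rewrite -expRM_natl; congr expR; lra.
have : (9 / 8) ^+ 8 <= expR (1 / 8) ^+ 8 :> R by rewrite lerXn2r ?nnegrE ?expR_ge0//; lra.
by apply: le_trans; rewrite -subr_ge0; lra.
Qed.

(** From e^(-1/4) >= 3/4, as (3/4)^8 is just above 1/10. This is what gives ln (1 / delta) >= 2 for
    delta < 1/10. *)
Lemma expR2_lt10 (R : realType) : expR 2 < 10 :> R.
Proof.
have e4 : 3 / 4 <= expR (- (1 / 4)) :> R by have := @expR_ge1Dx R (- (1 / 4)); lra.
have : (3 / 4) ^+ 8 <= expR (- (1 / 4)) ^+ 8 :> R by rewrite lerXn2r ?nnegrE ?expR_ge0//; lra.
rewrite -expRM_natl => h; have {h} : (3 / 4) ^+ 8 <= expR (- 2) :> R.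
  by apply: le_trans h _; rewrite ler_expR; lra.
rewrite expRN => h; have {h} : (3 / 4) ^+ 8 * expR 2 <= 1 :> R.
  by rewrite -ler_pdivlMr ?expR_gt0// div1r.
have := expR_gt0 (2 : R); lra.
Qed.

(** Used with d = delta and e = exp (l - 1): the shift by 1 keeps e d <= 2/5, so the error costs at
    most 0.404, while l >= 2 gives (l - 1) 4/9 - 0.404 >= l / 50. *)
Lemma two_point_numeric (R : realFieldType) (l e d P0 P1 X : R) :
    2 <= l -> e * d <= 2 / 5 -> 0 <= e -> 4 / 9 <= P0 ->
    0 <= P1 -> P1 <= 101 / 100 * d -> (l - 1) * P0 <= (e - 1) * P1 + X ->
  l / 50 <= X.
Proof.
move=> l2 ed e0 P0ge P1ge P1le H.
have h1 : (e - 1) * P1 <= e * (101 / 100 * d).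
  apply: le_trans (_ : e * P1 <= _); last by rewrite ler_wpM2l.
  by rewrite ler_wpM2r// gerBl.
have h2 : (l - 1) * (4 / 9) <= (l - 1) * P0 by rewrite ler_wpM2l//; lra.
lra.
Qed.

Section PullBounds.
Context {R : realType} (n m : nat) (eps delta B : R) (sigma2 : 'I_n -> R).
Hypotheses (eps0 : 0 < eps) (delta0 : 0 < delta) (delta1 : delta < 1 / 10).
Hypotheses (m0 : (0 < m)%N) (mn : (2 * m < n)%N) (sigma2_gt0 : forall i, 0 < sigma2 i).
Variable st : two_level_stats m eps delta sigma2 B.
Implicit Types (H L A S : {set 'I_n}) (i : 'I_n).
Local Notation l := (ln (1 / delta)).
Local Notation W := (\sum_i sigma2 i).

Lemma ln_inv_delta_ge2 : 2 <= l.
Proof.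
rewrite -(expRK 2) ler_ln ?posrE ?expR_gt0 ?divr_gt0//.
apply: le_trans (ltW (expR2_lt10 R)) _; rewrite ler_pdivlMr//.
by move: delta1; lra.
Qed.

Lemma expR_ln_inv_delta : expR (l - 1) * delta <= 2 / 5.
Proof.
rewrite expRD lnK ?posrE ?divr_gt0// mulrAC div1r mulVf ?gt_eqF// mul1r expRN.
rewrite (_ : 2 / 5 = (5 / 2)^-1); last by rewrite invf_div.
by rewrite lef_pV2 ?posrE ?expR_gt0// ?divr_gt0//; exact: expR1_ge.
Qed.

Lemma sum_ret_split H L (E : {set 'I_n} -> bool) :
  1 - 101 / 100 * delta <= \sum_(A | E A) ret st H L A + \sum_(A | ~~ E A) ret st H L A.
Proof.
apply: le_trans (ret_good st H L) _.
have <- : \sum_A ret st H L A = \sum_(A | E A) ret st H L A + \sum_(A | ~~ E A) ret st H L A.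
  by rewrite (bigID E).
rewrite [leRHS](bigID (good_set m eps (two_level_mean eps H L)))/= lerDl.
by apply: sumr_ge0 => A _; exact: ret_ge0.
Qed.

Lemma ret_bad H L (E : {set 'I_n} -> bool) :
    (forall A, #|A| = m -> good_set m eps (two_level_mean eps H L) A -> ~~ E A) ->
  \sum_(A | E A) ret st H L A <= 101 / 100 * delta.
Proof.
move=> gE; have := ret_good st H L.
have : \sum_(A | good_set m eps (two_level_mean eps H L) A) ret st H L A <=
    \sum_(A | ~~ E A) ret st H L A.
  rewrite big_mkcond [leRHS]big_mkcond/=; apply: ler_sum => A _.
  case: ifP => gA; last by case: ifP => // _; exact: ret_ge0.
  have [Am|Am] := eqVneq #|A| m; first by rewrite gE.
  by rewrite ret_card// if_same.
have := sum_ret_le1 st H L xpredT; rewrite (bigID E)/=; lra.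
Qed.

(** Arm i is either returned or omitted with probability at least 4/9. If returned, lowering it
    turns this into an error; if omitted, raising it does, as i |: S is then the only correct
    output. *)
Lemma pull_ge_log S i : #|S| = m.-1 -> i \notin S ->
  sigma2 i * l / 100 <= eps ^+ 2 * pull st S finset.set0 i.
Proof.
move=> Sm iS; have l2 := ln_inv_delta_ge2; have el := expR_ln_inv_delta.
have main P0 P1 : 4 / 9 <= P0 -> 0 <= P1 <= 101 / 100 * delta ->
    (l - 1) * P0 <= (expR (l - 1) - 1) * P1 + 2 * eps ^+ 2 / sigma2 i * pull st S finset.set0 i ->
    sigma2 i * l / 100 <= eps ^+ 2 * pull st S finset.set0 i.
  move=> P0ge /andP[P1ge P1le] H.
  have h3 := two_point_numeric l2 el (expR_ge0 _) P0ge P1ge P1le H.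
  have := ler_wpM2l (ltW (sigma2_gt0 i)) h3.
  have -> : sigma2 i * (2 * eps ^+ 2 / sigma2 i * pull st S finset.set0 i) =
      2 * (eps ^+ 2 * pull st S finset.set0 i) by field; rewrite gt_eqF.
  by move: (_ * pull _ _ _ _) => x; lra.
have := sum_ret_split S finset.set0 (fun A : {set 'I_n} => i \in A).
set Pin := \sum_(A : {set 'I_n} | i \in A) _.
set Pout := \sum_(A : {set 'I_n} | i \notin A) _ => Psum.
have l1 : 0 <= l - 1 by lra.
have [Pi|Pi] := lerP (4 / 9) Pin.
  have iL : i \notin finset.set0 by rewrite inE.
  apply: main Pi _ (ret_lower st S (fun A : {set 'I_n} => i \in A) l1 iL).
  rewrite sumr_ge0/= => [|A _]; last exact: ret_ge0.
  apply: ret_bad => A _; rewrite finset.setU0; apply: (good_set_low eps0 m0 _ iS); lia.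
have Po : 4 / 9 <= Pout by move: delta1; lra.
apply: main Po _ (ret_raise st finset.set0 (fun A : {set 'I_n} => i \notin A) l1 iS).
rewrite sumr_ge0/= => [|A _]; last exact: ret_ge0.
have cardH : #|i |: S| = m by rewrite cardsU1 iS Sm; lia.
apply: ret_bad => A Am gA; rewrite (good_set_top eps0 m0 cardH Am gA).
by rewrite negbK finset.setU11.
Qed.

Lemma log_bound : W * l / 200 <= eps ^+ 2 * B.
Proof.
have l2 := ln_inv_delta_ge2.
(* The good arms are chosen light, so that the arms to which [pull_ge_log] applies carry at least W
   / 2. *)
have [S Sm Sw] : exists2 S : {set 'I_n}, #|S| = m.-1 & \sum_(i in S) sigma2 i <= W / 2.
  by apply: exists_light_subset => [|i]; [lia|exact: ltW].
have : \sum_(i | i \notin S) sigma2 i * l / 100 <= eps ^+ 2 * B.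
  apply: le_trans (_ : \sum_(i | i \notin S) eps ^+ 2 * pull st S finset.set0 i <= _).
    by apply: ler_sum => i iS; exact: pull_ge_log.
  rewrite -mulr_sumr ler_wpM2l ?sqr_ge0//; apply: le_trans (sum_pull_le st S finset.set0).
  rewrite [leRHS](bigID (mem S))/= lerDr; apply: sumr_ge0 => i _; exact: pull_ge0.
apply: le_trans; rewrite -!mulr_suml.
have WE : W = \sum_(i in S) sigma2 i + \sum_(i | i \notin S) sigma2 i.
  by rewrite (bigID (mem S)).
have : W / 2 * l <= (\sum_(i | i \notin S) sigma2 i) * l.
  by rewrite ler_wpM2r//; [lra|move: Sw; rewrite WE; lra].
lra.
Qed.

End PullBounds.

(** * Random subsets with independent inclusions *)

Section RandomSubset.
Context {R : realFieldType} (I : finType) (x : I -> R).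
Hypothesis x01 : forall i, 0 <= x i <= 1.
Implicit Types (S : {set I}) (i : I).

(** Law of the set that contains each i independently with probability x i. *)
Definition subset_weight S : R := \prod_i (if i \in S then x i else 1 - x i).

Lemma subset_weight_ge0 S : 0 <= subset_weight S.
Proof.
by apply: prodr_ge0 => i _; have /andP[? ?] := x01 i; case: ifP; rewrite ?subr_ge0.
Qed.

Lemma sum_subset_weight : \sum_(S : {set I}) subset_weight S = 1.
Proof.
transitivity (\prod_i (x i + (1 - x i))).
  rewrite bigA_distr; apply: eq_bigr => S _; rewrite /subset_weight.
  by apply: eq_bigr => i _.
by rewrite big1// => i _; rewrite addrC subrK.
Qed.

(** Both sides differ only by the factor 1 - x i <= 1 contributed by i on the left. *)
Lemma subset_weight_setU1 S i : i \notin S ->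
  subset_weight S * x i <= subset_weight (i |: S).
Proof.
move=> iS; rewrite /subset_weight (bigD1 i)//= (negbTE iS) [leRHS](bigD1 i)//= finset.setU11.
rewrite (eq_bigr (fun j => if j \in i |: S then x j else 1 - x j)) => [|j ji]; last first.
  by rewrite finset.in_setU1 (negbTE ji).
have /andP[xi0 xi1] := x01 i.
rewrite mulrAC ler_wpM2r ?ler_piMl ?gerBl//.
by apply: prodr_ge0 => j _; have /andP[? ?] := x01 j; case: ifP; rewrite ?subr_ge0.
Qed.

Lemma subset_weight_eq0 S i : i \in S -> x i = 0 -> subset_weight S = 0.
Proof. by move=> iS xi; rewrite /subset_weight (bigD1 i)//= iS xi mul0r. Qed.

Lemma sum_subset_weight_mem i : \sum_(S : {set I} | i \in S) subset_weight S = x i.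
Proof.
transitivity (\prod_j ((if j == i then x i else x j) + (if j == i then 0 else 1 - x j))).
  rewrite bigA_distr [LHS]big_mkcond; apply: eq_bigr => S _.
  have [iS|iS] := boolP (i \in S).
    by apply: eq_bigr => j _; have [->|ji] := eqVneq j i; rewrite ?iS.
  by rewrite [RHS](bigD1 i)//= (negbTE iS) eqxx mul0r.
rewrite (bigD1 i)//= eqxx addr0 big1 ?mulr1// => j /negbTE ->.
by rewrite addrC subrK.
Qed.

(** Markov's inequality for the size of the random set. *)
Lemma sum_subset_weight_large m :
  m%:R * \sum_(S : {set I} | (m < #|S|)%N) subset_weight S <= \sum_i x i.
Proof.
under [leRHS]eq_bigr do rewrite -sum_subset_weight_mem big_mkcond.
rewrite exchange_big/= mulr_sumr big_mkcond; apply: ler_sum => S _.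
rewrite -big_mkcond sumr_const -[leRHS]mulr_natl /=.
case: ifP => mS; last by rewrite mulr_ge0// subset_weight_ge0.
by rewrite ler_wpM2r ?subset_weight_ge0// ler_nat ltnW.
Qed.

Lemma sum_subset_weight_avoid i m :
  1 - x i - \sum_(S : {set I} | (m < #|S|)%N) subset_weight S <=
  \sum_(S : {set I} | (#|S| <= m)%N && (i \notin S)) subset_weight S.
Proof.
rewrite -[X in X - _ - _]sum_subset_weight -sum_subset_weight_mem !lerBlDr.
rewrite [X in _ <= X + _ + _]big_mkcond [X in _ <= _ + X + _]big_mkcond.
rewrite [X in _ <= _ + _ + X]big_mkcond -!big_split/=.
apply: ler_sum => S _; rewrite ltnNge.
have := subset_weight_ge0 S.
by case: (#|S| <= m)%N; case: (i \in S) => /=; lra.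
Qed.

(** (S, i) -> (i |: S, i) is a bijection from pairs with i outside the set to pairs with i
    inside. *)
Lemma sum_setU1 (F : {set I} -> I -> R) (P : pred I) :
  \sum_(S : {set I}) \sum_(i | (i \notin S) && P i) F (i |: S) i =
  \sum_(S : {set I}) \sum_(i | (i \in S) && P i) F S i.
Proof.
rewrite (exchange_big_dep P)/= => [|S i _ /andP[]//].
rewrite [RHS](exchange_big_dep P)/= => [|S i _ /andP[]//].
apply: eq_bigr => i Pi.
rewrite [RHS](reindex_onto (fun S => i |: S) (fun S => S :\ i)) /=; last first.
  by move=> S /andP[iS _]; rewrite finset.setD1K.
apply: eq_bigl => S; rewrite Pi !andbT finset.setU11/=.
apply/idP/eqP => [iS|<-]; first by rewrite finset.setU1K.
by rewrite !inE eqxx.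
Qed.

End RandomSubset.

(** * Lower bound by averaging over random sets of good arms *)

Lemma mixture_numeric (R : realFieldType) (W b X1 X2 X3 X4 : R) :
    8 / 9 * X1 - 4 * W * X2 <= X3 * (2 * b) -> X4 <= X1 -> W * X2 <= W -> X3 * b <= b ->
  8 / 9 * X4 - 4 * W <= 2 * b.
Proof. by lra. Qed.

Section MixtureBound.
Context {R : realType} (n m : nat) (eps delta B : R) (sigma2 : 'I_n -> R).
Hypotheses (m0 : (0 < m)%N) (mn : (2 * m < n)%N) (sigma2_gt0 : forall i, 0 < sigma2 i).
Implicit Types (H L A S : {set 'I_n}) (i : 'I_n).
Local Notation W := (\sum_i sigma2 i).

Definition capped_inv i : R := Num.min m%:R (W / sigma2 i).

(** Without the cap m this is W times the entropy of all the variances. *)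
Definition capped_entropy : R := \sum_i sigma2 i * ln (capped_inv i).

Lemma sigma2_le_sum i : sigma2 i <= W.
Proof. by rewrite (bigD1 i)//= lerDl; apply: sumr_ge0 => j _; exact: ltW. Qed.

Lemma capped_inv_ge1 i : 1 <= capped_inv i.
Proof. by rewrite le_min ler1n m0/= ler_pdivlMr// mul1r sigma2_le_sum. Qed.

Lemma ln_capped_inv_ge0 i : 0 <= ln (capped_inv i).
Proof. exact/ln_ge0/capped_inv_ge1. Qed.

Lemma sigma2_sum_gt0 : 0 < W.
Proof.
have i : 'I_n by exists 0%N; lia.
exact: lt_le_trans (sigma2_gt0 i) (sigma2_le_sum i).
Qed.

Hypotheses (eps0 : 0 < eps) (delta1 : delta < 1 / 10).
Variable st : two_level_stats m eps delta sigma2 B.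

Section Filler.
Variable D0 : {set 'I_n}.
Hypothesis cardD0 : #|D0| = m.

(* Completes a random set of m - r good arms to a set of m arms. *)
Definition filler (r : nat) : {set 'I_n} := [set i in take r (enum D0)].

Lemma card_filler r : (r <= m)%N -> #|filler r| = r.
Proof.
move=> rm; rewrite cardsE; have /card_uniqP -> := take_uniq r (enum_uniq (mem D0)).
by rewrite size_takel// -cardE cardD0.
Qed.

Lemma filler_sub r i : i \in filler r -> i \in D0.
Proof. by rewrite inE => /mem_take; rewrite mem_enum. Qed.

(** Arms of D0 are reserved as filler. The factor 1/4 keeps the mean size of the random set at most
    m / 4 and leaves each arm out with probability at least 3/4. *)
Definition inclusion i : R :=
  if i \in D0 then 0 else Num.min 1 (m%:R * sigma2 i / W) / 4.

Lemma inclusion_bounds i : 0 <= inclusion i <= 1 / 4.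
Proof.
rewrite /inclusion; case: ifP => _; first by rewrite lexx divr_ge0.
rewrite divr_ge0 ?ler_pM2r ?invr_gt0// ?ge_min ?lexx//.
by rewrite le_min ler01 divr_ge0 ?mulr_ge0// ltW// sigma2_sum_gt0.
Qed.

Lemma inclusion01 i : 0 <= inclusion i <= 1.
Proof. by have /andP[i0 i1] := inclusion_bounds i; apply/andP; split => //; lra. Qed.

Lemma sum_inclusion : \sum_i inclusion i <= m%:R / 4.
Proof.
have W0 := sigma2_sum_gt0.
apply: le_trans (_ : \sum_i m%:R / 4 / W * sigma2 i <= _).
  apply: ler_sum => i _; rewrite /inclusion; case: ifP => _.
    by rewrite mulr_ge0 ?divr_ge0// ltW.
  rewrite (_ : m%:R / 4 / W * sigma2 i = m%:R * sigma2 i / W / 4); last first.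
    by field; rewrite gt_eqF.
  by rewrite ler_pM2r ?invr_gt0// ge_min lexx orbT.
by rewrite -mulr_sumr divfK// gt_eqF.
Qed.

(** With e^t = [capped_inv i], the error sigma2 i e^t of the change of measure becomes 4 W times the
    probability of drawing i, which is what turns the weight of S into that of i |: S. *)
Lemma inclusion_capped_inv i : i \notin D0 ->
  4 * W * inclusion i = sigma2 i * capped_inv i.
Proof.
move=> iD; have W0 := sigma2_sum_gt0; rewrite /inclusion (negbTE iD) /capped_inv.
rewrite (_ : 4 * W * _ = W * Num.min 1 (m%:R * sigma2 i / W)); last by field.
rewrite [LHS]minr_pMr ?(ltW W0)// [RHS]minr_pMr ?(ltW (sigma2_gt0 i))//.
rewrite mulr1 minC; congr Num.min.
  by field; rewrite gt_eqF.
by field; rewrite gt_eqF.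
Qed.

(* With S and its filler good there are m + 1 good arms; the output omits exactly i. *)
Definition swap_prob S i : R :=
  ret st (S :|: filler (m.+1 - #|S|)) finset.set0 ((S :\ i) :|: filler (m.+1 - #|S|)).

Lemma swap_prob_ge0 S i : 0 <= swap_prob S i.
Proof. exact: ret_ge0. Qed.

(** An arm i of S outside D0 is missing from its own output only, so the outputs are distinct and
    their probabilities, under one instance, sum to at most 1. *)
Lemma sum_swap_prob S : \sum_(i | (i \in S) && (i \notin D0)) swap_prob S i <= 1.
Proof.
pose T := filler (m.+1 - #|S|); pose h i := (S :\ i) :|: T.
pose J := [set i in S | i \notin D0].
have hinj : {in J &, injective h}.
  move=> i j; rewrite !inE => /andP[iS iD] /andP[jS jD] hij; apply/eqP.
  have : i \notin h i by rewrite !inE eqxx/=; apply: contra iD => /mem_take; rewrite mem_enum.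
  by rewrite hij !inE iS andbT negb_or negbK => /andP[].
apply: le_trans (sum_ret_le1 st (S :|: T) finset.set0 (fun A => A \in h @: J)).
rewrite (big_imset _ hinj)/= le_eqVlt; apply/orP; left; apply/eqP.
by apply: eq_bigl => i; rewrite inE.
Qed.

(** The change of measure for the event that the output is H: H is the only correct output before i
    is raised, and after the raise it is the output that misses i. *)
Lemma pull_ge_swap S i : [disjoint S & D0] -> (#|S| <= m)%N ->
    (i \notin S) && (i \notin D0) ->
  8 / 9 * (sigma2 i * ln (capped_inv i)) - 4 * W * inclusion i * swap_prob (i |: S) i <=
  2 * (eps ^+ 2 * pull st (S :|: filler (m - #|S|)) finset.set0 i).
Proof.
move=> dS Sm /andP[iS iD]; set H := S :|: filler (m - #|S|).
have iF r : i \notin filler r by apply: contra iD; exact: filler_sub.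
have iH : i \notin H by rewrite inE negb_or iS iF.
have cH : #|H| = m.
  rewrite cardsU (_ : S :&: _ = finset.set0) ?cards0 ?subn0 ?card_filler ?leq_subr ?subnKC//.
  apply/finset.setP => j; rewrite !inE; apply/negP => /andP[jS] /mem_take.
  rewrite mem_enum => jD; have := pred0P dS j; by rewrite /= jS jD.
(* The m + 1 in [swap_prob] keeps the filler fixed: m - |S| = m + 1 - |i |: S|. *)
have HE : i |: H = (i |: S) :|: filler (m.+1 - #|i |: S|).
  by rewrite cardsU1 iS add1n subSS finset.setUA.
have HE' : H = (i |: S) :\ i :|: filler (m.+1 - #|i |: S|).
  by rewrite cardsU1 iS add1n subSS finset.setU1K.
have g := ret_good st H finset.set0.
have {g} retH : 8 / 9 <= ret st H finset.set0 H.
  apply: le_trans (_ : 1 - 101 / 100 * delta <= _); first by move: delta1; lra.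
  apply: le_trans g _; rewrite big_mkcond (bigD1 H)//= big1 ?addr0.
    by case: ifP => // _; exact: ret_ge0.
  move=> A AH; case: ifP => // gA; have [Am|Am] := eqVneq #|A| m; last exact: ret_card.
  by rewrite (good_set_top eps0 m0 cH Am gA) eqxx in AH.
have cap1 := capped_inv_ge1 i; have capE : expR (ln (capped_inv i)) = capped_inv i.
  by rewrite lnK// posrE (lt_le_trans ltr01).
have l0 := ln_capped_inv_ge0 i.
have := ret_raise st finset.set0 (pred1 H) l0 iH; rewrite !big_pred1_eq capE => raise.
rewrite inclusion_capped_inv//.
have -> : swap_prob (i |: S) i = ret st (i |: H) finset.set0 H.
  by rewrite /swap_prob -HE -HE'.
have {raise} raise := ler_wpM2l (ltW (sigma2_gt0 i)) raise.
have r0 := ret_ge0 st (i |: H) finset.set0 H.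
move: (ret st (i |: H) finset.set0 H) r0 raise => r r0.
have -> : sigma2 i * ((capped_inv i - 1) * r + 2 * eps ^+ 2 / sigma2 i * pull st H finset.set0 i) =
    sigma2 i * capped_inv i * r - sigma2 i * r + 2 * (eps ^+ 2 * pull st H finset.set0 i).
  by field; rewrite gt_eqF.
have : 8 / 9 * (sigma2 i * ln (capped_inv i)) <= sigma2 i * (ln (capped_inv i) * ret st H finset.set0 H).
  by rewrite mulrC -mulrA ler_wpM2l ?(ltW (sigma2_gt0 i))// ler_wpM2l.
have : 0 <= sigma2 i * r by rewrite mulr_ge0 ?(ltW (sigma2_gt0 i)).
move: (_ * pull _ _ _ _) (sigma2 i * (_ * ret _ _ _ _)) (sigma2 i * ln _) (sigma2 i * r)
  (sigma2 i * capped_inv i * r).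
by move=> a b c d e; lra.
Qed.

Local Notation w := (subset_weight inclusion).
Local Notation v := (fun i => sigma2 i * ln (capped_inv i)).

Lemma mixture_bound_filler :
  8 / 9 * (\sum_(i | i \notin D0) v i / 2) - 4 * W <= 2 * (eps ^+ 2 * B).
Proof.
have i01 := inclusion01; have W0 := sigma2_sum_gt0; have w0 S := subset_weight_ge0 i01 S.
have v0 i : 0 <= v i by rewrite mulr_ge0 ?ln_capped_inv_ge0// ltW.
have B0 : 0 <= eps ^+ 2 * B.
  rewrite mulr_ge0 ?sqr_ge0//; apply: le_trans (sum_pull_le st finset.set0 finset.set0).
  by apply: sumr_ge0 => i _; exact: pull_ge0.
have perS S : (#|S| <= m)%N ->
    w S * (8 / 9 * (\sum_(i | (i \notin S) && (i \notin D0)) v i)) -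
    4 * W * \sum_(i | (i \notin S) && (i \notin D0)) w (i |: S) * swap_prob (i |: S) i
    <= w S * (2 * (eps ^+ 2 * B)).
  (* A set meeting D0 has weight 0, and only the nonpositive term remains. *)
  move=> Sm; have [dS|ndS] := boolP [disjoint S & D0]; last first.
    have [i /= /andP[iS iD]] := pred0Pn ndS.
    rewrite (subset_weight_eq0 iS) ?mul0r ?sub0r; last by rewrite /inclusion iD.
    rewrite oppr_le0 mulr_ge0 ?mulr_ge0 ?(ltW W0)//; apply: sumr_ge0 => j _.
    by rewrite mulr_ge0// swap_prob_ge0.
  apply: le_trans (_ : w S * \sum_(i | (i \notin S) && (i \notin D0))
      (8 / 9 * v i - 4 * W * inclusion i * swap_prob (i |: S) i) <= _).
    rewrite sumrB mulrBr -mulr_sumr lerB// [leLHS]mulr_sumr [leRHS]mulr_sumr; apply: ler_sum => i /andP[iS _].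
    rewrite [leLHS](_ : _ = 4 * W * (w S * inclusion i * swap_prob (i |: S) i)); last by ring.
    rewrite ler_wpM2l ?mulr_ge0 ?(ltW W0)// ler_wpM2r ?swap_prob_ge0//.
    exact: subset_weight_setU1.
  rewrite ler_wpM2l//; apply: le_trans (_ : \sum_(i | (i \notin S) && (i \notin D0))
      2 * (eps ^+ 2 * pull st (S :|: filler (m - #|S|)) finset.set0 i) <= _).
    by apply: ler_sum => i ?; exact: pull_ge_swap.
  rewrite -!mulr_sumr ler_wpM2l// ler_wpM2l ?sqr_ge0//.
  apply: le_trans (sum_pull_le st (S :|: filler (m - #|S|)) finset.set0).
  by rewrite big_mkcond; apply: ler_sum => i _; case: ifP => // _; exact: pull_ge0.
(* Arm i is avoided by a set of size at most m with probability at least 1 - 1/4 - 1/4. *)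
have gain : \sum_(i | i \notin D0) v i / 2 <=
    \sum_(S : {set 'I_n} | (#|S| <= m)%N) w S * (\sum_(i | (i \notin S) && (i \notin D0)) v i).
  under [leRHS]eq_bigr do rewrite mulr_sumr.
  rewrite (exchange_big_dep (fun i => i \notin D0))/= => [|S i _ /andP[]//].
  apply: ler_sum => i iD; rewrite -mulr_suml mulrC ler_wpM2r//.
  rewrite (eq_bigl (fun S : {set 'I_n} => (#|S| <= m)%N && (i \notin S))); last first.
    by move=> S; rewrite iD andbT.
  apply: le_trans (sum_subset_weight_avoid i01 i m).
  have large : \sum_(S : {set 'I_n} | (m < #|S|)%N) w S <= 1 / 4.
    have := le_trans (sum_subset_weight_large i01 m) sum_inclusion.
    by rewrite div1r ler_pM2l// ltr0n.
  by have /andP[_] := inclusion_bounds i; lra.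
(* Reindexed by i |: S, the loss is at most an average of the sums in [sum_swap_prob]: all arms
   together cost one unit. *)
have loss : \sum_(S : {set 'I_n} | (#|S| <= m)%N)
    \sum_(i | (i \notin S) && (i \notin D0)) w (i |: S) * swap_prob (i |: S) i <= 1.
  apply: le_trans (_ : \sum_(S : {set 'I_n})
      \sum_(i | (i \notin S) && (i \notin D0)) w (i |: S) * swap_prob (i |: S) i <= _).
    rewrite [leRHS](bigID (fun S : {set 'I_n} => (#|S| <= m)%N))/= lerDl.
    by apply: sumr_ge0 => S _; apply: sumr_ge0 => i _; rewrite mulr_ge0// swap_prob_ge0.
  rewrite (sum_setU1 (fun S i => w S * swap_prob S i) (fun i => i \notin D0)).
  rewrite -(sum_subset_weight inclusion); apply: ler_sum => S _.
  by rewrite -mulr_sumr ler_piMr// sum_swap_prob.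
have tot : \sum_(S : {set 'I_n} | (#|S| <= m)%N) w S <= 1.
  rewrite -(sum_subset_weight inclusion) big_mkcond; apply: ler_sum => S _.
  by case: ifP.
have : \sum_(S : {set 'I_n} | (#|S| <= m)%N)
    (w S * (8 / 9 * (\sum_(i | (i \notin S) && (i \notin D0)) v i)) -
    4 * W * \sum_(i | (i \notin S) && (i \notin D0)) w (i |: S) * swap_prob (i |: S) i)
    <= \sum_(S : {set 'I_n} | (#|S| <= m)%N) w S * (2 * (eps ^+ 2 * B)).
  by apply: ler_sum => S Sm; exact: perS.
rewrite sumrB -mulr_sumr.
rewrite (eq_bigr (fun S => 8 / 9 * (w S * (\sum_(i | (i \notin S) && (i \notin D0)) v i)))); last first.
  by move=> S _; rewrite mulrCA.
rewrite -mulr_sumr => main.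
have lossW := ler_wpM2l (ltW W0) loss; rewrite mulr1 in lossW.
have totB := ler_wpM2r B0 tot; rewrite mul1r in totB.
rewrite -mulr_suml in main.
exact: mixture_numeric main gain lossW totB.
Qed.

End Filler.

(** The filler D0 is chosen light for the terms of [capped_entropy], so the other arms keep at least
    half of it. *)
Lemma mixture_bound : capped_entropy / 9 - 2 * W <= eps ^+ 2 * B.
Proof.
have v0 i : 0 <= sigma2 i * ln (capped_inv i).
  by rewrite mulr_ge0 ?ln_capped_inv_ge0// ltW.
have [D0 cD0 D0v] := exists_light_subset (ltnW mn) v0.
have := mixture_bound_filler cD0; rewrite -mulr_suml => mix.
have FE : capped_entropy = \sum_(i in D0) sigma2 i * ln (capped_inv i) +
    \sum_(i | i \notin D0) sigma2 i * ln (capped_inv i) 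
  by rewrite /capped_entropy (bigID (mem D0)).
rewrite -/capped_entropy in D0v.
by move: mix D0v; rewrite FE; lra.
Qed.

End MixtureBound.

(** * Comparison of the grouped terms with the capped entropy *)

Section Groups.
Context {R : realType} (n m : nat) (sigma2 : 'I_n -> R).
Hypotheses (m0 : (0 < m)%N) (mn : (2 * m < n)%N) (sigma2_gt0 : forall i, 0 < sigma2 i).
Implicit Types (A : {set 'I_n}) (i : 'I_n).
Local Notation W := (\sum_i sigma2 i).
Local Notation s0 := (sigma_min sigma2).

Lemma sigma_min_attained : exists i, s0 = sigma2 i.
Proof.
have j : 'I_n by exists 0%N; lia.
have [i _ E] := @eq_bigmin _ (\bar R) 'I_n +oo%E j predT (fun i => (sigma2 i)%:E)
  isT (fun i _ => leey _).
by exists i; rewrite /sigma_min E.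
Qed.

Lemma sigma_min_gt0 : 0 < s0.
Proof. by have [i ->] := sigma_min_attained. Qed.

Lemma sigma_min_le i : s0 <= sigma2 i.
Proof.
have [k E] := sigma_min_attained; rewrite E -lee_fin.
have := @bigmin_le _ (\bar R) 'I_n +oo%E i (fun i => (sigma2 i)%:E).
apply: le_trans; rewrite -E /sigma_min.
have j : 'I_n by exists 0%N; lia.
have [i' _ E'] := @eq_bigmin _ (\bar R) 'I_n +oo%E j predT (fun i => (sigma2 i)%:E)
  isT (fun i _ => leey _).
by rewrite E'.
Qed.

Lemma mem_groupE i k : i \in group sigma2 k.+1 ->
  2 ^+ k * s0 <= sigma2 i < 2 ^+ k.+1 * s0.
Proof. by rewrite inE ler_pdivlMr ?ltr_pdivrMr ?sigma_min_gt0. Qed.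

Lemma exists_group i : exists k, i \in group sigma2 k.+1.
Proof.
have g0 := sigma_min_gt0.
have ex : exists j, sigma2 i / s0 < 2 ^+ j.
  by exists (Num.Def.archi_bound (sigma2 i / s0)); exact: upper_nthrootP.
case: (ex_minnP ex) => -[|k] ltk mink.
  by have := sigma_min_le i; rewrite leNgt -[s0]mul1r -ltr_pdivrMr// -(expr0 2) ltk.
exists k; rewrite inE ltk andbT leNgt; apply/negP => /mink.
by rewrite ltnn.
Qed.

(** The group of i has more than 2 m arms, each of variance at least sigma2 i / 2, so W >= m sigma2
    i. *)
Lemma capped_inv_large_group i : in_Gm m sigma2 i -> capped_inv m sigma2 i = m%:R.
Proof.
move=> [[|k] [//_ [ik large]]]; apply/min_idPl; rewrite ler_pdivlMr//.
have /andP[_ ilt] := mem_groupE ik.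
apply: le_trans (_ : \sum_(j in group sigma2 k.+1) sigma2 j <= _); last first.
  rewrite [leRHS](bigID (mem (group sigma2 k.+1)))/= lerDl.
  by apply: sumr_ge0 => j _; exact: ltW.
apply: le_trans (_ : \sum_(j in group sigma2 k.+1) sigma2 i / 2 <= _).
  rewrite sumr_const -[leRHS]mulr_natr [leLHS]mulrC -[leRHS]mulrA.
  rewrite ler_wpM2l ?(ltW (sigma2_gt0 i))// mulrC ler_pdivlMr// -natrM ler_nat; lia.
apply: ler_sum => j /mem_groupE/andP[jge _]; apply: le_trans jge.
by move: ilt; rewrite exprS; lra.
Qed.

(** Shifting the index gives S(J + 1) = 2 S(J) + 2 (J + 1). Only S(J) <= 4 * 2^J is used later. *)
Lemma sum_pow_weights (J : nat) :
  \sum_(k < J) 2 ^+ k.+1 * (J - k)%:R + 2 * J%:R + 4 = 2 ^+ J.+2 :> R.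
Proof.
elim: J => [|J IH]; first by rewrite big_ord0 !expr2; lra.
rewrite big_ord_recl subn0 expr1.
rewrite (eq_bigr (fun k : 'I_J => 2 * (2 ^+ k.+1 * (J - k)%:R))) => [|k _]; last first.
  by rewrite lift0 subSS exprS mulrA.
by rewrite -mulr_sumr -natr1 [RHS]exprS -IH; lra.
Qed.

Lemma ln2_le1 : ln (2 : R) <= 1.
Proof. by have := @le_ln1Dx R 1; apply; lra. Qed.

(** Let J be least with X <= 2^J s0. An arm of group k + 1 contributes at most 2^(k+1) s0 (J - k),
    and each group has at most 2 m arms in A; the sum over k is dominated by its top groups. *)
Lemma sum_group_ln A (X : R) : 0 < X ->
    (forall k, #|A :&: group sigma2 k.+1| <= 2 * m)%N ->
  \sum_(i in A | sigma2 i < X) sigma2 i * ln (X / sigma2 i) <= 16 * (m%:R * X).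
Proof.
move=> X0 cA; have g0 := sigma_min_gt0.
have ex : exists J, X <= 2 ^+ J * s0.
  exists (Num.Def.archi_bound (X / s0)); rewrite -ler_pdivrMr//.
  by apply/ltW; exact: upper_nthrootP.
case: (ex_minnP ex) => J XJ minJ.
pose c k : R := 2 ^+ k.+1 * (J - k)%:R.
have c0 k : 0 <= c k * s0 by rewrite mulr_ge0 ?(ltW g0)// mulr_ge0.
have term i : sigma2 i < X ->
    sigma2 i * ln (X / sigma2 i) <= \sum_(k < J | i \in group sigma2 k.+1) c k * s0.
  move=> iX; have [k ik] := exists_group i; have /andP[ge_i lt_i] := mem_groupE ik.
  have kJ : (k < J)%N.
    rewrite ltnNge; apply/negP => Jk; have := lt_le_trans (le_lt_trans ge_i iX) XJ.
    by rewrite ltr_pM2r// ltNge ler_weXn2l//; lra.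
  rewrite (bigD1 (Ordinal kJ))//=; apply: ler_wpDr.
    by apply: sumr_ge0.
  rewrite mulrAC; apply: ler_pM => //; [exact: ltW| |exact: ltW|].
    by apply: ln_ge0; rewrite ler_pdivlMr// mul1r ltW.
  apply: le_trans (_ : ln (2 ^+ (J - k)) <= _).
    rewrite ler_ln ?posrE ?divr_gt0 ?exprn_gt0// ler_pdivrMr//; apply: le_trans XJ _.
    by rewrite -[in leLHS](subnK (ltnW kJ)) exprD -mulrA ler_wpM2l ?exprn_ge0.
  by rewrite lnXn// -[leLHS]mulr_natl ler_piMr// ln2_le1.
apply: le_trans (_ : \sum_(i in A) \sum_(k < J | i \in group sigma2 k.+1) c k * s0 <= _).
  rewrite big_mkcondr; apply: ler_sum => i iA; case: ifP => [|_]; first exact: term.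
  exact: sumr_ge0.
rewrite (exchange_big_dep xpredT)//=.
apply: le_trans (_ : \sum_(k < J) (2 * m)%:R * (c k * s0) <= _).
  apply: ler_sum => k _; rewrite sumr_const -[leLHS]mulr_natl ler_wpM2r// ler_nat.
  apply: leq_trans (cA k); apply/subset_leq_card/fintype.subsetP => i.
  by rewrite finset.in_setI.
rewrite -mulr_sumr -mulr_suml.
have := sum_pow_weights J; rewrite -/(c _); set S := \sum_(k < J) _ => SE.
have S4 : S <= 4 * 2 ^+ J.
  have := ler0n R J; move: SE; rewrite !exprS; lra.
(* For J = 0 the sum is empty; otherwise minimality gives 2^(J-1) s0 < X, so 4 * 2^J s0 <= 8 X. *)
case: J XJ minJ @c c0 term @S SE S4 => [|J] XJ minJ c c0 term S SE S4.
  by rewrite /S big_ord0 mul0r mulr0 !mulr_ge0// ltW.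
have XJ' : 2 ^+ J * s0 < X.
  by rewrite ltNge; apply/negP => /minJ; rewrite ltnn.
have : S * s0 <= 8 * X.
  apply: le_trans (_ : 4 * 2 ^+ J.+1 * s0 <= _); first by rewrite ler_wpM2r// ltW.
  by rewrite exprS; lra.
move=> /(ler_wpM2l (ler0n R (2 * m))) /le_trans; apply.
by rewrite natrM; lra.
Qed.

Lemma admissible_card A k : admissible_Gr m sigma2 A ->
  (#|A :&: group sigma2 k.+1| <= 2 * m)%N.
Proof.
move=> /(_ k.+1 isT)[small large]; have [/[dup] le2m /small ->//|] := leqP #|group sigma2 k.+1| (2 * m).
by move=> /large ->.
Qed.

(** A contains all the small groups, so the left side is at most WA Ent(A), the sum over A of
    sigma_i^2 ln (WA / sigma_i^2), and WA <= W. The part of ln (W / sigma_i^2) above ln m is left to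
    [sum_group_ln]. *)
Lemma Ent_admissible A : admissible_Gr m sigma2 A ->
  (\sum_(i | `[< in_Gl m sigma2 i >]) sigma2 i) * Ent sigma2 A <=
  capped_entropy m sigma2 + 16 * W.
Proof.
move=> adA; pose WA := \sum_(i in A) sigma2 i.
have W0 : 0 < W by apply: (@sigma2_sum_gt0 _ _ m).
have v0 i : 0 <= sigma2 i * ln (capped_inv m sigma2 i).
  by rewrite mulr_ge0 ?ln_capped_inv_ge0// ltW.
have F0 : 0 <= capped_entropy m sigma2 by exact: sumr_ge0.
have WA0 : 0 <= WA by apply: sumr_ge0 => i _; exact: ltW.
have sWA i : i \in A -> sigma2 i <= WA.
  by move=> iA; rewrite /WA (bigD1 i)//= lerDl; apply: sumr_ge0 => j _; exact: ltW.
have WAW : WA <= W.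
  rewrite [leRHS](bigID (mem A))/= lerDl; apply: sumr_ge0 => j _; exact: ltW.
have [WAE|WA1] := eqVneq WA 0.
  have -> : Ent sigma2 A = 0.
    by rewrite /Ent big1 ?oppr0 => [|i _]; last rewrite -/WA WAE invr0 mulr0 mul0r.
  by rewrite mulr0 addr_ge0// mulr_ge0// ltW.
have {WA1} WA1 : 0 < WA by rewrite lt_neqAle eq_sym WA1.
have EntE : WA * Ent sigma2 A = \sum_(i in A) sigma2 i * ln (WA / sigma2 i).
  rewrite /Ent -/WA -sumrN mulr_sumr; apply: eq_bigr => i _.
  rewrite -[WA / sigma2 i]invf_div lnV ?posrE ?divr_gt0//.
  by field; rewrite gt_eqF.
have Ent0 : 0 <= Ent sigma2 A.
  rewrite -(pmulr_rge0 _ WA1) EntE; apply: sumr_ge0 => i iA.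
  by rewrite mulr_ge0 ?(ltW (sigma2_gt0 i))// ln_ge0// ler_pdivlMr// mul1r sWA.
apply: le_trans (_ : WA * Ent sigma2 A <= _).
  rewrite ler_wpM2r// big_mkcond [leRHS]big_mkcond; apply: ler_sum => i _.
  case: ifPn => [/asboolP[[|k] [//_ [ik small]]]|_]; last by case: ifP => // _; exact: ltW.
  have [AE _] := adA k.+1 isT; have := ik; rewrite -(AE small) inE => /andP[-> _]; exact: lexx.
(* At variance X the two arguments of the minimum in [capped_inv] agree; below X, ln (W / sigma_i^2)
   = ln m + ln (X / sigma_i^2). *)
rewrite EntE; pose X := W / m%:R.
have X0 : 0 < X by rewrite divr_gt0// ltr0n.
have -> : 16 * W = 16 * (m%:R * X) by rewrite /X [m%:R * _]mulrC divfK// pnatr_eq0 -lt0n.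
apply: le_trans (lerD (lexx _) (sum_group_ln X0 (fun k => admissible_card k adA))).
apply: le_trans (_ : \sum_(i in A) sigma2 i * ln (capped_inv m sigma2 i) +
    \sum_(i in A | sigma2 i < X) sigma2 i * ln (X / sigma2 i) <= _); last first.
  rewrite lerD2r /capped_entropy [leRHS](bigID (mem A))/= lerDl.
  by apply: sumr_ge0.
rewrite [X in _ + X]big_mkcondr -big_split/=; apply: ler_sum => i iA.
have mR : 0 < m%:R :> R by rewrite ltr0n.
apply: le_trans (_ : sigma2 i * ln (W / sigma2 i) <= _).
  rewrite ler_wpM2l ?(ltW (sigma2_gt0 i))// ler_ln ?posrE ?divr_gt0//.
  by rewrite ler_wpM2r// invr_ge0 ltW.
rewrite /capped_inv; case: ifPn => iX.
  rewrite -mulrDr ler_wpM2l ?(ltW (sigma2_gt0 i))// min_l; last first.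
    by rewrite ler_pdivlMr// mulrC -ler_pdivlMr// ltW.
  rewrite -lnM ?posrE ?divr_gt0//.
  by rewrite (_ : m%:R * _ = W / sigma2 i)// /X; field; rewrite !gt_eqF.
rewrite addr0 min_r// ler_pdivrMr// mulrC -ler_pdivrMr// leNgt//.
Qed.

Lemma sum_Gl_Ent_Gr :
  (\sum_(i | `[< in_Gl m sigma2 i >]) sigma2 i) * Ent_Gr m sigma2 <=
  capped_entropy m sigma2 + 16 * W.
Proof.
have F0 : 0 <= capped_entropy m sigma2.
  by apply: sumr_ge0 => i _; rewrite mulr_ge0 ?ln_capped_inv_ge0// ltW.
have := Ent_admissible; set Wl := \sum_(i | _) sigma2 i => EntA.
(* The default 0 of the maximum is harmless because the right side is nonnegative. *)
rewrite /Ent_Gr; elim/big_ind: _ => [|x y hx hy|A /asboolP].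
- by rewrite mulr0 addr_ge0// mulr_ge0// ltW//; apply: (@sigma2_sum_gt0 _ _ m).
- by case: (leP x y).
- exact: EntA.
Qed.

Lemma sum_Gm_ln : \sum_(i | `[< in_Gm m sigma2 i >]) sigma2 i * ln m%:R <=
  capped_entropy m sigma2.
Proof.
rewrite big_mkcond; apply: ler_sum => i _; case: ifPn => [/asboolP im|_].
  by rewrite capped_inv_large_group.
by rewrite mulr_ge0 ?ln_capped_inv_ge0// ltW.
Qed.

End Groups.

(** * Combination of the bounds *)

Lemma lower_bound_numeric (R : realFieldType) (l W F LB T2 T3 e : R) :
    2 <= l -> 0 < W -> W * l / 200 <= e * (100 ^- 2 * LB) ->
    F / 9 - 2 * W <= e * (100 ^- 2 * LB) -> T2 <= F -> T3 <= F + 16 * W ->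
  e * LB = W * l + T2 + T3 -> False.
Proof.
(* With y = e LB > 0, the hypotheses give W l <= y / 50, W <= y / 100 and F <= y / 5, so y <= W l +
   2 F + 16 W < y. *)
move=> l2 W0; have lW : 2 * W <= W * l by rewrite mulrC ler_wpM2l// ltW.
have -> : e * (100 ^- 2 * LB) = (e * LB) / 10000 by field.
by move: (e * LB) (W * l) lW => y z; lra.
Qed.

Theorem theorem3 (R : realType) :
  exists c : R, 0 < c /\
  forall (eps delta : R) (n m : nat) (sigma2 : 'I_n -> R) (pi : policy R n),
    0 < eps -> 0 < delta -> delta < 1 / 10 ->
    (0 < m)%N -> (2 * m < n)%N ->
    (forall i, 0 < sigma2 i) ->
    is_algorithm m pi ->
    solves m eps delta sigma2 pi ->
    exists nu : 'I_n -> probability R R,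
      instance_of sigma2 nu /\
      ((c * lower_bound m eps delta sigma2)%:E <= expected_samples pi nu)%E.
Proof.
exists (100 ^- 2); split; first by rewrite invr_gt0 exprn_gt0.
move=> eps delta n m sigma2 pi eps0 delta0 delta1 m0 mn sigma2_gt0 pi_alg slv.
(* If no instance is hard, c LB bounds the expected number of samples on every instance and serves
   as B. *)
apply: contrapT => /forallNP no_nu.
set LB := lower_bound m eps delta sigma2 in no_nu.
have leB nu : instance_of sigma2 nu -> (expected_samples pi nu <= (100 ^- 2 * LB)%:E)%E.
  by move=> inu; rewrite leNgt; apply/negP => /ltW ltnu; apply: (no_nu nu).
have [st _] := exists_two_level_stats sigma2_gt0 pi_alg delta0 slv leB.
have A := log_bound eps0 delta0 delta1 m0 mn sigma2_gt0 st.
have F := mixture_bound m0 mn sigma2_gt0 eps0 delta1 st.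
have l2 := ln_inv_delta_ge2 delta0 delta1.
have Gm := sum_Gm_ln m0 mn sigma2_gt0; have Gl := sum_Gl_Ent_Gr m0 mn sigma2_gt0.
have W0 := sigma2_sum_gt0 m0 mn sigma2_gt0.
have LBE : eps ^+ 2 * LB = (\sum_i sigma2 i) * ln (1 / delta) +
    \sum_(i | `[< in_Gm m sigma2 i >]) sigma2 i * ln m%:R +
    (\sum_(i | `[< in_Gl m sigma2 i >]) sigma2 i) * Ent_Gr m sigma2.
  rewrite /LB /lower_bound !mulrDr !mulr_sumr mulr_suml mulr_suml.
  by congr (_ + _ + _); apply: eq_bigr => i _; field; rewrite gt_eqF.
exact: (lower_bound_numeric l2 W0 A F Gm Gl LBE).
Qed.
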